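(* Let $h:(0,1)\to(0,\infty)$ be a continuous function with $\lim_{t\to 0^+}h(t)=0$. Let $(z_n)_{n\ge 1}$, $z_n=r_ne^{i\theta_n}$ with $r_n\in(0,1)$ and $\theta_n\in\mathbb{R}$, be a Blaschke sequence in the unit disc $\mathbb{D}$ such that $\sum_{n=1}^{\infty}h(1-r_n)<\infty$, and let $B$ be the Blaschke product with zeros $(z_n)_{n\ge1}$. Let $\gamma\in(-1,0)$. Suppose that there is $q\in(1+\gamma/2,1]$ such that $h(t)/t^{q}$ is decreasing and $h(t)/t^{2+\gamma-q}$ is increasing on $(0,1)$. Then, for any $p\ge q$, \[ \int_{0}^{1}\int_{0}^{2\pi}|B'(r\rho e^{i\theta})|^{p}\,\rho(1-\rho^2)^{\gamma}\,d\theta\,d\rho=\frac{O(1)}{(1-r)^{p-\gamma-2}\,h(1-r)}\qquad (r\to1^-). \] Moreover, if $\lim_{t\to0^+}h(t)/t^{2+\gamma-q}=0$, then $O(1)$ can be replaced by $o(1)$, i.e. for any $p\ge q$, \[ \int_{0}^{1}\int_{0}^{2\pi}|B'(r\rho e^{i\theta})|^{p}\,\rho(1-\rho^2)^{\gamma}\,d\theta\,d\rho=\frac{o(1)}{(1-r)^{p-\gamma-2}\,h(1-r)}\qquad (r\to1^-). \]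
   Context: $\mathbb{D}$ is the open unit disc in $\mathbb{C}$. A Blaschke sequence is a sequence $(z_n)_{n\ge1}$ in $\mathbb{D}\setminus\{0\}$ with $\sum_{n}(1-|z_n|)<\infty$; the Blaschke product with these zeros is $B(z)=\prod_{n=1}^{\infty}\frac{|z_n|}{z_n}\,\frac{z_n-z}{1-\bar z_n z}$, $z\in\mathbb{D}$, which is analytic and bounded by $1$ on $\mathbb{D}$. ''Increasing'' and ''decreasing'' are understood in the weak (non-strict) sense. *)

(* Defs.v *)
From HB Require Import structures.
From mathcomp Require Import all_boot all_order all_algebra.
From mathcomp Require Import complex.
From mathcomp Require Import all_classical all_reals all_analysis.

Set Implicit Arguments.
Unset Strict Implicit.
Unset Printing Implicit Defensive.

Import Order.TTheory GRing.Theory Num.Theory.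
Import numFieldNormedType.Exports.
Import Normc.

Local Open Scope classical_set_scope.
Local Open Scope ring_scope.
Local Open Scope complex_scope.

Section BlaschkeProducts.
Context {R : realType}.
Implicit Types (z : nat -> R[i]) (w : R[i]).

Definition polarC (r t : R) : R[i] := (r * cos t) +i* (r * sin t).

(* [normc] is the modulus as an element of R; the norm [`|w|] lives in R[i]. *)
Definition blaschke_sequence z : Prop :=
  (forall n, 0 < normc (z n) < 1) /\
  cvgn (series (fun n => 1 - normc (z n))).

Definition blaschke_factor (a w : R[i]) : R[i] :=
  (normc a)%:C / a * ((a - w) / (1 - a^*%C * w)).

(* Topologically, R[i] is used as the normed module R[i]^o over itself, so that
   [derive1] below is the complex derivative. Only the values on the unit disc
   are meaningful: elsewhere the partial products need not converge. *)
Definition blaschke_product z w : R[i] :=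
  limn (fun N => \prod_(n < N) blaschke_factor (z n) w : R[i]^o).

(* The weight is integrated over the open interval ]0, 1[; the endpoints form a
   null set. *)
Definition weighted_mean_integral (f : R[i] -> R[i]) (p g r : R) : \bar R :=
  let mu := @lebesgue_measure R in
  let df : R[i] -> R[i] := derive1 (f : R[i] -> R[i]^o) in
  (\int[mu]_(rho in `]0%R, 1%R[)
     \int[mu]_(theta in `[0%R, (2 * pi)%R])
       (normc (df (polarC (r * rho) theta)) `^ p
          * (rho * (1 - rho ^+ 2) `^ g))%:E)%E.

End BlaschkeProducts.

(* Main.v *)
(* Write d = 1 - r_n and t = 1 - r.  A telescoping estimate of the partial
   products gives |B'(w)| <= 4 sum_n d / |1 - conj(z_n) w|^2, and the Schwarz-Pick
   lemma gives |B'(w)| <= 2 / (1 - |w|).  For p >= q the second bound yields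
   |B'|^p <= (2/t)^(p-q) |B'|^q, and as q <= 1 the power |B'|^q is at most the sum
   of the q-th powers.  Since 2q > 2 + gamma, integrating each term over the disc
   leaves
     d^q (1 - r_n r)^(2+gamma-2q)  <=  d^q max(d, t)^(2+gamma-2q),
   and multiplying by t^(q-gamma-2) h(t) the two monotonicity hypotheses on h
   (one for d <= t, the other for t <= d) bound the result by h(d), which is
   summable.  If h(t)/t^(2+gamma-q) -> 0 each term tends to 0, and dominated
   convergence of the series gives o(1).

   The two one-dimensional integrals are estimated by dyadic decomposition.
   B' is never shown to exist or to be measurable: only upper bounds on the
   integral are needed, and these hold without measurability. *)

Require Import Defs.
From mathcomp Require Import all_boot all_order all_algebra.
From mathcomp Require Import complex.
From mathcomp Require Import all_classical all_reals all_analysis.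
From mathcomp Require Import measurable_realfun ring lra.
Import Order.TTheory GRing.Theory Num.Theory.
Import numFieldNormedType.Exports.
Import Normc.
Local Open Scope classical_set_scope.
Local Open Scope ring_scope.

Set Implicit Arguments.
Unset Strict Implicit.
Unset Printing Implicit Defensive.

(** * Modulus of complex numbers and Blaschke factors *)

Section ComplexModulus.
Local Open Scope complex_scope.
Context {R : realType}.
Implicit Types a w v x y : R[i].

Lemma normr_normc x : `|x| = (normc x)%:C.
Proof. by case: x. Qed.

Lemma normc_ge0 x : 0 <= normc x.
Proof. by case: x => u v; exact: sqrtr_ge0. Qed.

Lemma sqr_normcE (u v : R) : normc (u +i* v) ^+ 2 = u ^+ 2 + v ^+ 2.
Proof. by rewrite /normc sqr_sqrtr// addr_ge0// sqr_ge0. Qed.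

Lemma normcD_le x y : normc (x + y) <= normc x + normc y.
Proof. exact: le_normcD. Qed.

Lemma normc_opp x : normc (- x) = normc x.
Proof. exact: normcN. Qed.

Lemma normc_distC x y : normc (x - y) = normc (y - x).
Proof. by rewrite -normc_opp opprB. Qed.

Lemma normcB_ge x y : normc x - normc y <= normc (x - y).
Proof. by rewrite lerBlDr -{1}(subrK y x) normcD_le. Qed.

Lemma normc_real (u : R) : normc u%:C = `|u|.
Proof. by rewrite /normc/= expr0n/= addr0 sqrtr_sqr. Qed.

Lemma normc_conj x : normc x^*%C = normc x.
Proof. by case: x => u v /=; rewrite sqrrN. Qed.

Lemma normc_conj_mul x : x * x^*%C = ((normc x) ^+ 2)%:C.
Proof. by rewrite -sqr_normc normr_normc rmorphXn. Qed.

Lemma normc_gt0 x : x != 0 -> 0 < normc x.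
Proof.
by move=> x0; rewrite lt_def normc_ge0 andbT; apply: contra x0 => /eqP/eq0_normc ->.
Qed.

Lemma ReIm_le_normc x : `|complex.Re x| <= normc x /\ `|complex.Im x| <= normc x.
Proof.
case: x => u v /=; split; rewrite -sqrtr_sqr ler_wsqrtr//.
  by rewrite lerDl sqr_ge0.
by rewrite lerDr sqr_ge0.
Qed.

Lemma normc_den_ge a w : normc a <= 1 -> 1 - normc w <= normc (1 - a^*%C * w).
Proof.
move=> a1; apply: le_trans (normcB_ge _ _).
rewrite normc1 lerD2l lerN2 normcM normc_conj.
by rewrite ler_piMl// normc_ge0.
Qed.

Lemma den_neq0 a w : normc a <= 1 -> normc w < 1 -> 1 - a^*%C * w != 0.
Proof.
move=> a1 w1; apply/eqP => e; have := normc_den_ge w a1.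
by rewrite e normc0; lra.
Qed.

(** Divided by the squared denominator, this gives 1 - |b(w)|^2 exactly for a Blaschke factor b;
    both |b| <= 1 and the equality case of Schwarz-Pick come from it. *)
Lemma normc_sub_den a w :
  normc (a - w) ^+ 2 + (1 - normc a ^+ 2) * (1 - normc w ^+ 2) =
  normc (1 - a^*%C * w) ^+ 2.
Proof.
case: a w => [a1 a2] [w1 w2].
have -> : 1 - (a1 +i* a2)^*%C * (w1 +i* w2) =
    (1 - a1 * w1 - a2 * w2) +i* (a2 * w1 - a1 * w2) :> R[i].
  by apply/eqP; rewrite eq_complex /=; apply/andP; split; apply/eqP; ring.
have -> : (a1 +i* a2) - (w1 +i* w2) = (a1 - w1) +i* (a2 - w2) :> R[i] by [].
by rewrite !sqr_normcE; ring.
Qed.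

Lemma normc_blaschke_factor a w : a != 0 ->
  normc (blaschke_factor a w) = normc (a - w) / normc (1 - a^*%C * w).
Proof.
move=> a0; rewrite /blaschke_factor !normcM !normcV normc_real.
by rewrite ger0_norm ?normc_ge0// divff ?mul1r// gt_eqF// normc_gt0.
Qed.

Lemma one_sub_blaschke_factor a w : a != 0 -> normc a <= 1 -> normc w < 1 ->
  1 - normc (blaschke_factor a w) ^+ 2 =
  (1 - normc a ^+ 2) * (1 - normc w ^+ 2) / normc (1 - a^*%C * w) ^+ 2.
Proof.
move=> a0 a1 w1; rewrite normc_blaschke_factor// expr_div_n.
have d0 : normc (1 - a^*%C * w) ^+ 2 != 0.
  by rewrite expf_neq0// gt_eqF// normc_gt0// den_neq0.
by apply: (mulIf d0); rewrite mulrBl !mulfVK// -normc_sub_den mul1r addrC addKr.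
Qed.

Lemma sqr_normc_le1 x : normc x <= 1 -> 0 <= 1 - normc x ^+ 2.
Proof. by move=> x1; rewrite subr_ge0 expr_le1// normc_ge0. Qed.

Lemma blaschke_factor_le1 a w : a != 0 -> normc a <= 1 -> normc w < 1 ->
  normc (blaschke_factor a w) <= 1.
Proof.
move=> a0 a1 w1.
rewrite -(@expr_le1 _ 2)// ?normc_ge0// -subr_ge0 one_sub_blaschke_factor//.
apply: divr_ge0; last exact: exprn_ge0 (normc_ge0 _).
by apply: mulr_ge0; apply: sqr_normc_le1 => //; exact: ltW.
Qed.

(** The cross products (a - w)(1 - conj(a) v) and (a - v)(1 - conj(a) w) differ by (v - w)(1 -
    |a|^2), and |a|/a has modulus one. *)
Lemma normc_blaschke_factorB a w v : a != 0 -> normc a <= 1 ->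
  normc w < 1 -> normc v < 1 ->
  normc (blaschke_factor a w - blaschke_factor a v) =
  normc (w - v) * (1 - normc a ^+ 2) /
    (normc (1 - a^*%C * w) * normc (1 - a^*%C * v)).
Proof.
move=> a0 a1 w1 v1.
have dw := den_neq0 a1 w1; have dv := den_neq0 a1 v1.
have -> : blaschke_factor a w - blaschke_factor a v =
    (normc a)%:C / a * ((v - w) * (1 - a * a^*%C) /
      ((1 - a^*%C * w) * (1 - a^*%C * v))).
  by rewrite /blaschke_factor; field; rewrite dw dv a0.
rewrite normc_conj_mul !normcM !normcV normcM normc_real ger0_norm ?normc_ge0//.
rewrite divff ?gt_eqF ?normc_gt0// mul1r normc_distC.
by rewrite -[1 - _%:C](rmorphB (real_complex R) 1) normc_real ger0_norm// sqr_normc_le1.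
Qed.

(** Makes the increments of the partial products summable. Since |a|^2 = a conj(a), the factor 1 -
    |a| splits off, leaving 1 + w|a|/a, of modulus at most 2, over the denominator. *)
Lemma normc_one_sub_blaschke_factor a w : a != 0 -> normc a <= 1 ->
  normc w < 1 ->
  normc (1 - blaschke_factor a w) <= 2 / (1 - normc w) * (1 - normc a).
Proof.
move=> a0 a1 w1.
have dw := den_neq0 a1 w1.
have na0 := normc_gt0 a0.
have -> : 1 - blaschke_factor a w =
    (1 - normc a)%:C * (1 + w * ((normc a)%:C / a)) / (1 - a^*%C * w).
  have e : (normc a)%:C ^+ 2 - a * a^*%C = 0.
    by rewrite normc_conj_mul rmorphXn subrr.
  apply/eqP; rewrite -subr_eq0 rmorphB rmorph1; apply/eqP.
  transitivity (w * ((normc a)%:C ^+ 2 - a * a^*%C) / (a * (1 - a^*%C * w))).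
    by rewrite /blaschke_factor; field; rewrite dw a0.
  by rewrite e mulr0 mul0r.
rewrite normcM normcM normcV normc_real ger0_norm ?subr_ge0//.
rewrite [leRHS]mulrC -mulrA ler_wpM2l ?subr_ge0//.
rewrite ler_pM ?normc_ge0 ?invr_ge0 ?normc_ge0//.
  apply: le_trans (normcD_le _ _) _; rewrite normc1 !normcM normc_real normcV.
  rewrite ger0_norm ?normc_ge0// divff ?gt_eqF// mulr1.
  by lra.
by rewrite lef_pV2 ?posrE ?normc_gt0 ?subr_gt0// normc_den_ge.
Qed.

End ComplexModulus.

(** * Schwarz-Pick estimates for finite products *)

Section SchwarzPick.
Local Open Scope complex_scope.
Context {R : realType}.
Implicit Types x y v w : R[i].

Lemma sqrtr_cauchy_schwarz (p q r s : R) : 0 <= p -> 0 <= q -> 0 <= r -> 0 <= s ->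
  Num.sqrt (p * q) + Num.sqrt (r * s) <= Num.sqrt ((p + r) * (q + s)).
Proof.
move=> p0 q0 r0 s0.
rewrite -(@ler_pXn2r _ 2)// ?nnegrE ?addr_ge0 ?sqrtr_ge0//.
rewrite sqr_sqrtr ?mulr_ge0 ?addr_ge0// !sqrtrM//.
move: (sqr_sqrtr p0) (sqr_sqrtr q0) (sqr_sqrtr r0) (sqr_sqrtr s0).
set P := Num.sqrt p; set Q := Num.sqrt q; set S := Num.sqrt r; set T := Num.sqrt s.
move=> <- <- <- <-; rewrite -subr_ge0.
have -> : (P ^+ 2 + S ^+ 2) * (Q ^+ 2 + T ^+ 2) - (P * Q + S * T) ^+ 2 =
  (P * T - S * Q) ^+ 2 by ring.
exact: sqr_ge0.
Qed.

(* The Pick-type estimate |x1 - x2| m <= d sqrt((1-|x1|^2)(1-|x2|^2)) is stable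
   under products by the Cauchy-Schwarz inequality. *)
Lemma pick_mul x1 x2 y1 y2 (m d : R) : 0 <= d -> 0 <= m ->
  normc x1 <= 1 -> normc x2 <= 1 -> normc y1 <= 1 -> normc y2 <= 1 ->
  normc (x1 - x2) * m <= d * Num.sqrt ((1 - normc x1 ^+ 2) * (1 - normc x2 ^+ 2)) ->
  normc (y1 - y2) * m <= d * Num.sqrt ((1 - normc y1 ^+ 2) * (1 - normc y2 ^+ 2)) ->
  normc (x1 * y1 - x2 * y2) * m <=
    d * Num.sqrt ((1 - normc (x1 * y1) ^+ 2) * (1 - normc (x2 * y2) ^+ 2)).
Proof.
move=> d0 m0 x11 x21 y11 y21 hx hy.
have -> : x1 * y1 - x2 * y2 = x1 * (y1 - y2) + y2 * (x1 - x2) by ring.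
have n1 := sqr_normc_le1 x11; have n2 := sqr_normc_le1 x21.
have n3 := sqr_normc_le1 y11; have n4 := sqr_normc_le1 y21.
apply: (@le_trans _ _ (normc x1 * (normc (y1 - y2) * m) +
    normc y2 * (normc (x1 - x2) * m))).
  by rewrite !mulrA -mulrDl ler_wpM2r// (le_trans (normcD_le _ _))// !normcM.
apply: (@le_trans _ _ (d * (Num.sqrt (normc x1 ^+ 2 * (1 - normc y1 ^+ 2) *
    (1 - normc y2 ^+ 2)) + Num.sqrt ((1 - normc x1 ^+ 2) * (normc y2 ^+ 2 *
    (1 - normc x2 ^+ 2)))))).
  rewrite mulrDr lerD//.
    rewrite -[X in Num.sqrt X]mulrA sqrtrM ?sqr_ge0// sqrtr_sqr ger0_norm ?normc_ge0//.
    by rewrite [leRHS]mulrCA ler_wpM2l ?normc_ge0.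
  rewrite [X in Num.sqrt X]mulrCA sqrtrM ?sqr_ge0// sqrtr_sqr ger0_norm ?normc_ge0//.
  by rewrite [leRHS]mulrCA ler_wpM2l ?normc_ge0.
rewrite ler_wpM2l//.
have p0 : 0 <= normc x1 ^+ 2 * (1 - normc y1 ^+ 2) by rewrite mulr_ge0 ?sqr_ge0.
have s0 : 0 <= normc y2 ^+ 2 * (1 - normc x2 ^+ 2) by rewrite mulr_ge0 ?sqr_ge0.
(* The sums under the root are 1 - |x1 y1|^2 = |x1|^2 (1 - |y1|^2) + (1 - |x1|^2) and 1 - |x2 y2|^2
   = (1 - |y2|^2) + |y2|^2 (1 - |x2|^2). *)
apply: le_trans (sqrtr_cauchy_schwarz p0 n4 n1 s0) _.
by rewrite !normcM ler_wsqrtr// le_eqVlt; apply/orP; left; apply/eqP; ring.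
Qed.

Variable z : nat -> R[i].
Hypothesis z01 : forall n, 0 < normc (z n) < 1.

Lemma blaschke_zero_neq0 n : z n != 0.
Proof.
by apply/eqP => zn; have := z01 n; rewrite zn normc0 ltxx.
Qed.

Lemma blaschke_zero_le1 n : normc (z n) <= 1.
Proof. by have /andP[_ /ltW] := z01 n. Qed.

Definition partial_blaschke N w : R[i] := \prod_(n < N) blaschke_factor (z n) w.

Lemma partial_blaschkeS N w :
  partial_blaschke N.+1 w = partial_blaschke N w * blaschke_factor (z N) w.
Proof. exact: big_ord_recr. Qed.

Lemma partial_blaschke_le1 N w : normc w < 1 -> normc (partial_blaschke N w) <= 1.
Proof.
move=> w1; elim: N => [|N IH].
  by rewrite /partial_blaschke big_ord0 normc1.
rewrite partial_blaschkeS normcM mulr_ile1 ?normc_ge0//.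
by rewrite blaschke_factor_le1 ?blaschke_zero_neq0 ?blaschke_zero_le1.
Qed.

(** A single factor attains equality, by the two exact formulas for factors; [pick_mul] carries the
    inequality through the product. *)
Lemma partial_blaschke_pick N w v : normc w < 1 -> normc v < 1 ->
  normc (partial_blaschke N w - partial_blaschke N v) *
    Num.sqrt ((1 - normc w ^+ 2) * (1 - normc v ^+ 2)) <=
  normc (w - v) * Num.sqrt ((1 - normc (partial_blaschke N w) ^+ 2) *
    (1 - normc (partial_blaschke N v) ^+ 2)).
Proof.
move=> w1 v1; elim: N => [|N IH].
  rewrite /partial_blaschke !big_ord0 subrr normc0 mul0r.
  by rewrite mulr_ge0 ?normc_ge0 ?sqrtr_ge0.
rewrite !partial_blaschkeS; apply: pick_mul => //; rewrite ?normc_ge0 ?sqrtr_ge0//;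
  rewrite ?partial_blaschke_le1 ?blaschke_factor_le1 ?blaschke_zero_neq0 ?blaschke_zero_le1//.
have z0 := blaschke_zero_neq0 N; have z1 := blaschke_zero_le1 N.
rewrite normc_blaschke_factorB// !one_sub_blaschke_factor//.
set A := 1 - normc (z N) ^+ 2; set W := 1 - normc w ^+ 2; set V := 1 - normc v ^+ 2.
have A0 : 0 <= A by exact: sqr_normc_le1.
have W0 : 0 <= W by exact/sqr_normc_le1/ltW.
have V0 : 0 <= V by exact/sqr_normc_le1/ltW.
set dw := normc (1 - _ * w); set dv := normc (1 - _ * v).
have dw0 : 0 < dw by rewrite normc_gt0// den_neq0.
have dv0 : 0 < dv by rewrite normc_gt0// den_neq0.
have -> : A * W / dw ^+ 2 * (A * V / dv ^+ 2) = (A / (dw * dv)) ^+ 2 * (W * V).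
  by field; rewrite ?gt_eqF.
rewrite [in leRHS]sqrtrM ?sqr_ge0// sqrtr_sqr ger0_norm; last first.
  by rewrite divr_ge0// mulr_ge0// ltW.
by rewrite !mulrA.
Qed.

Lemma partial_blaschke_lipschitz N w v : normc w < 1 ->
  normc (v - w) <= (1 - normc w) / 2 ->
  normc (partial_blaschke N v - partial_blaschke N w) <=
    2 / (1 - normc w) * normc (v - w).
Proof.
move=> w1 vw.
have w0 := normc_ge0 w; have v0 := normc_ge0 v.
have vle : normc v <= (1 + normc w) / 2.
  by have := normcB_ge v w; lra.
have v1 : normc v < 1 by lra.
have := partial_blaschke_pick N v1 w1.
set S := Num.sqrt ((1 - normc v ^+ 2) * _) => h.
(* Both 1 - |v|^2 and 1 - |w|^2 are at least (1 - |w|)/2, because v stays within half the distance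
   from w to the circle. *)
have S1 : (1 - normc w) / 2 <= S.
  rewrite -[leLHS]ger0_norm; last lra.
  by rewrite -sqrtr_sqr ler_wsqrtr// expr2 ler_pM//; nra.
have d1 : 0 < (1 - normc w) / 2 by lra.
rewrite mulrC -[2 / _]invf_div ler_pdivlMr//.
apply: le_trans (ler_wpM2l (normc_ge0 _) S1) _; apply: le_trans h _.
rewrite -[leRHS]mulr1 ler_wpM2l ?normc_ge0// -[leRHS]sqrtr1 ler_wsqrtr//.
by rewrite mulr_ile1 ?sqr_normc_le1 ?partial_blaschke_le1// gerBl sqr_ge0.
Qed.

(** Telescoping: one factor is exchanged at a time, and all the others have modulus at most one. *)
Lemma partial_blaschkeB_le N w v : normc w < 1 -> normc v < 1 ->
  normc (partial_blaschke N v - partial_blaschke N w) <=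
  \sum_(n < N) normc (blaschke_factor (z n) v - blaschke_factor (z n) w).
Proof.
move=> w1 v1; elim: N => [|N IH].
  by rewrite /partial_blaschke !big_ord0 subrr normc0.
rewrite big_ord_recr/= !partial_blaschkeS.
set a := blaschke_factor _ v; set b := blaschke_factor _ w.
have -> : partial_blaschke N v * a - partial_blaschke N w * b =
  (partial_blaschke N v - partial_blaschke N w) * a + partial_blaschke N w * (a - b).
  by ring.
apply: le_trans (normcD_le _ _) _; rewrite lerD//.
  rewrite normcM; apply: le_trans _ IH; rewrite ler_piMr ?normc_ge0//.
  by rewrite /a blaschke_factor_le1 ?blaschke_zero_neq0 ?blaschke_zero_le1.
by rewrite normcM ler_piMl ?normc_ge0 ?partial_blaschke_le1.
Qed.

Lemma partial_blaschkeB_sum N w v : normc w < 1 ->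
  normc (v - w) <= (1 - normc w) / 2 ->
  normc (partial_blaschke N v - partial_blaschke N w) <=
  4 * (\sum_(n < N) (1 - normc (z n)) / normc (1 - (z n)^*%C * w) ^+ 2) * normc (v - w).
Proof.
move=> w1 vw.
have w0 := normc_ge0 w; have v0 := normc_ge0 v.
have vle : normc v <= (1 + normc w) / 2.
  by have := normcB_ge v w; lra.
have v1 : normc v < 1 by lra.
apply: le_trans (partial_blaschkeB_le N w1 v1) _.
rewrite mulr_sumr mulr_suml; apply: ler_sum => n _.
have z0 := blaschke_zero_neq0 n; have z1 := blaschke_zero_le1 n.
rewrite normc_blaschke_factorB//.
set dw := normc (1 - _ * w); set dv := normc (1 - _ * v).
have dw0 : 0 < dw by rewrite normc_gt0// den_neq0.
have dv0 : 0 < dv by rewrite normc_gt0// den_neq0.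
(* The two denominators differ by at most |v - w|, which is at most half of the lower bound 1 - |w|
   of [dw]. This costs a factor 2; the other 2 in the constant 4 comes from 1 + |z_n| <= 2. *)
have dvw : dw <= 2 * dv.
  have : 1 - normc w <= dw by exact: normc_den_ge.
  have : dw - normc ((z n)^*%C * (v - w)) <= dv.
    have -> : dv = normc (1 - (z n)^*%C * w - (z n)^*%C * (v - w)).
      by congr normc; ring.
    exact: normcB_ge.
  rewrite normcM normc_conj.
  have : normc (z n) * normc (v - w) <= normc (v - w) by rewrite ler_piMl ?normc_ge0.
  by lra.
have n0 := normc_ge0 (z n).
rewrite -mulrA [leRHS]mulrC ler_wpM2l ?normc_ge0//.
rewrite ler_pdivrMr ?mulr_gt0//.
have -> : 4 * ((1 - normc (z n)) / dw ^+ 2) * (dv * dw) =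
  (1 - normc (z n)) * (4 * (dv / dw)) by field; rewrite gt_eqF.
have -> : 1 - normc (z n) ^+ 2 = (1 - normc (z n)) * (1 + normc (z n)) by ring.
rewrite ler_wpM2l ?subr_ge0//.
apply: (@le_trans _ _ 2); first lra.
rewrite mulrA ler_pdivlMr//; lra.
Qed.

End SchwarzPick.

(** * The derivative of a Blaschke product *)

Section ComplexLimits.
Local Open Scope complex_scope.
Context {R : realType}.

(** The norm of [R[i]] is itself [R[i]]-valued; a positive element of [R[i]] is real, so radii can
    be taken in [R]. *)
Lemma cvg_normcP (T : Type) (F : set_system T) (FF : Filter F) (f : T -> R[i]^o) (l : R[i]^o) :
  f @ F --> l <-> forall e : R, 0 < e -> \forall x \near F, normc (l - f x) < e.
Proof.
split=> [/cvgrPdist_lt h e e0|h].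
  have : \forall x \near F, `|l - f x| < e%:C by apply: h; rewrite ltcR.
  by apply: filterS => x; rewrite normr_normc ltcR.
apply/cvgrPdist_lt => e; case: e => a b; rewrite ltcE/= => /andP[/eqP -> a0].
by apply: filterS (h _ a0) => x ?; rewrite normr_normc ltcR.
Qed.

Lemma normc_lim_le (T : Type) (F : set_system T) (FF : ProperFilter F)
    (f : T -> R[i]^o) (l : R[i]^o) (M : R) :
  f @ F --> l -> (\forall x \near F, normc (f x) <= M) -> normc l <= M.
Proof.
move=> /cvg_normcP fl fM; rewrite leNgt; apply/negP => Ml.
have e0 : 0 < normc l - M by rewrite subr_gt0.
have [x [h1 h2]] := filter_ex (filterI (fl _ e0) fM).
by have := normcB_ge l (f x); move: h1 h2; lra.
Qed.

Lemma cvgn_of_increments (u e : nat -> R) : cvgn (series e) ->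
  (forall n, `|u n.+1 - u n| <= e n) -> cvgn u.
Proof.
move=> ce ue.
have ct : cvgn (series (fun n => u n.+1 - u n)).
  apply: normed_cvg; apply: series_le_cvg ce => //= n.
  exact: le_trans (ue n).
have -> : u = (fun n => u 0%N + series (fun n => u n.+1 - u n) n).
  apply/funext => n; rewrite seriesEnat/= telescope_sumr//; ring.
exact: is_cvgD (is_cvg_cst _) ct.
Qed.

Lemma cvgn_complex_of_increments (u : nat -> R[i]^o) (e : nat -> R) :
  cvgn (series e) -> (forall n, normc (u n.+1 - u n) <= e n) -> cvgn u.
Proof.
move=> ce ue.
have c1 : cvgn (fun n => complex.Re (u n) : R).
  apply: cvgn_of_increments ce _ => n; apply: le_trans _ (ue n).
  have [+ _] := ReIm_le_normc (u n.+1 - u n).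
  by case: (u n.+1) (u n) => ? ? [? ?].
have c2 : cvgn (fun n => complex.Im (u n) : R).
  apply: cvgn_of_increments ce _ => n; apply: le_trans _ (ue n).
  have [_ +] := ReIm_le_normc (u n.+1 - u n).
  by case: (u n.+1) (u n) => ? ? [? ?].
move: c1 c2 => /cvg_ex[/= a ha] /cvg_ex[/= b hb].
apply/cvg_ex; exists (a +i* b); apply/cvg_normcP => d d0.
have d2 : 0 < d / 2 by lra.
move/cvgrPdist_lt : ha => /(_ _ d2) ha; move/cvgrPdist_lt : hb => /(_ _ d2) hb.
apply: filterS2 ha hb => n /=; case: (u n) => x y /= hx hy.
rewrite -[ltRHS]gtr0_norm// -sqrtr_sqr ltr_sqrt ?exprn_gt0//.
move: hx hy; rewrite -[(a - x) ^+ 2]real_normK ?num_real//.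
rewrite -[(b - y) ^+ 2]real_normK ?num_real//.
set A := `|a - x|; set B := `|b - y|.
have A0 : 0 <= A := normr_ge0 _.
have B0 : 0 <= B := normr_ge0 _.
nra.
Qed.

(* When the limit of the difference quotients does not exist, [derive1] takes
   the value [point], which is [0]. *)
Lemma normc_derive1_le (f : R[i] -> R[i]^o) (a : R[i]) (d M : R) : 0 < d -> 0 <= M ->
  (forall v, normc (v - a) <= d -> normc (f v - f a) <= M * normc (v - a)) ->
  normc (derive1 f a : R[i]) <= M.
Proof.
move=> d0 M0 hf; rewrite /derive1.
set F := (fun h => _); set G := (X in lim X).
have [cF|ncF] := pselect (cvg G); last by rewrite dvgP// normc0.
apply: normc_lim_le cF _; rewrite /F; near=> h.
have h0 : h != 0 by near: h; exact: nbhs_dnbhs_neq.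
have hd : normc h <= d.
  have : `|h| <= d%:C by near: h; apply: dnbhs0_le; rewrite ltcR.
  by rewrite normr_normc lecR.
rewrite -[_ *: _]/(_ * _) normcM normcV mulrC ler_pdivrMr ?normc_gt0//.
by have := hf (h + a); rewrite addrK; exact.
Unshelve. all: by end_near. Qed.

End ComplexLimits.

Section BlaschkeDerivative.
Local Open Scope complex_scope.
Context {R : realType}.
Variable z : nat -> R[i].
Hypothesis zB : blaschke_sequence z.

Let z01 : forall n, 0 < normc (z n) < 1 := zB.1.

(** Up to sign, an increment is the current partial product, bounded by one, times 1 - b_n(w); it is
    dominated by a constant multiple of the summable 1 - |z_n|. *)
Lemma cvg_partial_blaschke w : normc w < 1 ->
  (fun N => partial_blaschke z N w : R[i]^o) @ \oo --> (blaschke_product z w : R[i]^o).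
Proof.
move=> w1.
(* [blaschke_product] is defined as this [limn], so existence of the limit is all that remains. *)
suff : cvgn (fun N => partial_blaschke z N w : R[i]^o) by [].
apply: (@cvgn_complex_of_increments _ _ (fun n => 2 / (1 - normc w) * (1 - normc (z n)))).
  have -> : series (fun n => 2 / (1 - normc w) * (1 - normc (z n))) =
    (fun N => 2 / (1 - normc w) * series (fun n => 1 - normc (z n)) N).
    by apply/funext => N; rewrite !seriesEnat/= mulr_sumr.
  exact: is_cvgMr zB.2.
move=> n; rewrite partial_blaschkeS.
rewrite -{2}[partial_blaschke z n w]mulr1 -mulrBr normcM normc_distC.
apply: le_trans _ (normc_one_sub_blaschke_factor _ _ w1) => //.
- by rewrite ler_piMl ?normc_ge0// partial_blaschke_le1.
- exact: blaschke_zero_neq0.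
- exact: blaschke_zero_le1.
Qed.

Lemma blaschke_productB_le w v (M : R) : normc w < 1 -> normc v < 1 ->
  (forall N, normc (partial_blaschke z N v - partial_blaschke z N w) <= M) ->
  normc (blaschke_product z v - blaschke_product z w) <= M.
Proof.
move=> w1 v1 hM.
have cv := cvgB (FF := eventually_filter) (cvg_partial_blaschke v1) (cvg_partial_blaschke w1).
have := @normc_lim_le R nat \oo _ _ _ M cv; apply.
by near=> N; exact: hM.
Unshelve. all: by end_near. Qed.

(** Only increments, uniformly in [N], pass to the limit product; limit and derivative are never
    interchanged. *)
Lemma normc_derive1_blaschke_le w (M : R) : normc w < 1 -> 0 <= M ->
  (forall N v, normc (v - w) <= (1 - normc w) / 2 ->
    normc (partial_blaschke z N v - partial_blaschke z N w) <= M * normc (v - w)) ->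
  normc (derive1 (blaschke_product z : R[i] -> R[i]^o) w : R[i]) <= M.
Proof.
move=> w1 M0 h.
apply: (@normc_derive1_le _ _ _ ((1 - normc w) / 2)) => //; first lra.
move=> v vw; apply: blaschke_productB_le => //.
  by have := normcB_ge v w; lra.
by move=> N; exact: h.
Qed.

Lemma derive1_blaschke_le w : normc w < 1 ->
  normc (derive1 (blaschke_product z : R[i] -> R[i]^o) w : R[i]) <= 2 / (1 - normc w).
Proof.
move=> w1; apply: normc_derive1_blaschke_le => //.
  by rewrite divr_ge0//; lra.
by move=> N v vw; exact: partial_blaschke_lipschitz.
Qed.

Lemma derive1_blaschke_le_sum w (T : R) : normc w < 1 ->
  (forall N, \sum_(n < N) (1 - normc (z n)) / normc (1 - (z n)^*%C * w) ^+ 2 <= T) ->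
  normc (derive1 (blaschke_product z : R[i] -> R[i]^o) w : R[i]) <= 4 * T.
Proof.
move=> w1 hT.
have T0 : 0 <= T by have := hT 0%N; rewrite big_ord0.
apply: normc_derive1_blaschke_le => //; first lra.
move=> N v vw; apply: le_trans (partial_blaschkeB_sum z01 _ w1 vw) _.
by rewrite ler_wpM2r ?normc_ge0// ler_wpM2l.
Qed.

End BlaschkeDerivative.

(** * Integrals of nonnegative functions *)

Section Integrals.
Context {R : realType}.

(* Unlike [ge0_le_integral], no measurability is needed: the integral of a
   nonnegative function is a supremum over the simple functions below it. *)
Lemma le_integral_nn d (T : measurableType d) (mu : {measure set T -> \bar R})
    (D : set T) (f g : T -> \bar R) :
  (forall x, D x -> (0 <= f x)%E) -> (forall x, D x -> (f x <= g x)%E) ->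
  (\int[mu]_(x in D) f x <= \int[mu]_(x in D) g x)%E.
Proof.
move=> f0 fg.
rewrite !ge0_integralE//; last by move=> x Dx; exact: le_trans (f0 x Dx) (fg x Dx).
apply: le_ereal_sup => _ [s /= sf <-]; exists s => //= x.
apply: le_trans (sf x) _; rewrite !patchE; case: ifPn => // xD.
by apply: fg; rewrite inE in xD.
Qed.

(** Monotone convergence is applied to the dominating series alone, so measurability is asked of the
    [g n] and not of [f]. *)
Lemma integral_le_nneseries d (T : measurableType d) (mu : {measure set T -> \bar R})
    (D : set T) (mD : measurable D) (f : T -> \bar R) (g : nat -> T -> R) (m : nat -> \bar R) :
  (forall x, D x -> (0 <= f x)%E) ->
  (forall n x, D x -> 0 <= g n x) ->
  (forall n, measurable_fun D (g n)) ->
  (forall x, D x -> (f x <= \sum_(0 <= n <oo) (g n x)%:E)%E) ->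
  (forall n, (\int[mu]_(x in D) (g n x)%:E <= m n)%E) ->
  (\int[mu]_(x in D) f x <= \sum_(0 <= n <oo) m n)%E.
Proof.
move=> f0 g0 mg fg gm.
apply: le_trans (le_integral_nn mu f0 fg) _.
rewrite integral_nneseries//.
- apply: lee_nneseries => // n _ _; apply: integral_ge0 => x Dx.
  by rewrite lee_fin g0.
- by move=> n; apply/measurable_EFinP.
Qed.

Lemma le_nneseries_term (u : nat -> \bar R) k : (forall n, (0 <= u n)%E) ->
  (u k <= \sum_(0 <= n <oo) u n)%E.
Proof.
move=> u0.
have h := @nneseries_lim_ge R u xpredT 0%N k.+1 (fun n _ _ => u0 n).
apply: le_trans _ h.
by rewrite big_nat_recr//= leeDr// sume_ge0.
Qed.

Lemma nneseries_geometric_le (M l : R) : 0 <= M -> 0 <= l < 1 ->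
  (\sum_(0 <= k <oo) (M * l ^+ k)%:E <= (M / (1 - l))%:E)%E.
Proof.
move=> M0 /andP[l0 l1].
have c := @cvg_geometric_series _ M l _.
rewrite ger0_norm// in c; have {}c := c l1.
rewrite (_ : (fun n => (\sum_(0 <= k < n) (M * l ^+ k)%:E)%E) =
   EFin \o series (geometric M l)); last first.
  by apply/funext => n /=; rewrite sumEFin.
by rewrite EFin_lim ?(cvg_lim _ c)//; apply: cvgP c.
Qed.

(** Common engine of the dyadic decompositions: the pieces [E k] may overlap and have only to cover
    the set where [f] is positive. There [f] is at most the sum over all [k] of [c k * w] on [E k],
    whose integrals decay geometrically. *)
Lemma integral_le_geometric d (T : measurableType d) (mu : {measure set T -> \bar R})
    (D : set T) (mD : measurable D) (f : T -> \bar R) (w : T -> R)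
    (c m : nat -> R) (E : nat -> set T) (M l : R) :
  (forall x, D x -> (0 <= f x)%E) ->
  (forall x, D x -> 0 <= w x) -> measurable_fun D w ->
  (forall k, measurable (E k)) -> (forall k, 0 <= c k) -> 0 <= M -> 0 <= l < 1 ->
  (forall x, D x -> (0 < f x)%E -> exists2 k, E k x & (f x <= (c k * w x)%:E)%E) ->
  (forall k, (\int[mu]_(x in D) (w x * \1_(E k) x)%:E <= (m k)%:E)%E) ->
  (forall k, c k * m k <= M * l ^+ k) ->
  (\int[mu]_(x in D) f x <= (M / (1 - l))%:E)%E.
Proof.
move=> f0 w0 mw mE c0 M0 l01 fE wE cm.
apply: le_trans _ (nneseries_geometric_le M0 l01).
have mwE k : measurable_fun D (fun x => w x * \1_(E k) x).
  by apply: measurable_funM => //; exact: measurable_indic.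
have g0 k x : D x -> 0 <= c k * (w x * \1_(E k) x).
  by move=> Dx; rewrite !mulr_ge0// ?w0// indicE.
apply: (integral_le_nneseries mD f0 (g := fun k x => c k * (w x * \1_(E k) x))) => //.
- by move=> k; apply: measurable_funM.
- move=> x Dx; have := f0 x Dx; rewrite le_eqVlt => /orP[/eqP <-|fx].
    by apply: nneseries_ge0 => n _ _; rewrite lee_fin g0.
  have [k Ekx fk] := fE x Dx fx.
  apply: le_trans (le_nneseries_term k _) => /=; last first.
    by move=> n; rewrite lee_fin g0.
  by rewrite indicE mem_set// mulr1.
- move=> k; under eq_integral do rewrite EFinM.
  rewrite ge0_integralZl//=.
  + apply: le_trans (_ : (c k * m k)%:E <= _)%E; last by rewrite lee_fin.
    by rewrite EFinM lee_wpmul2l// lee_fin.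
  + exact/measurable_EFinP.
  + by move=> x Dx; rewrite lee_fin mulr_ge0 ?w0// indicE.
  + by rewrite lee_fin.
Qed.

(** Take the least n with y < 2^n x; the assumption x <= y excludes n = 0, so n has a
    predecessor. *)
Lemma dyadic_bracket (x y : R) : 0 < x -> x <= y ->
  exists k, 2 ^+ k * x <= y < 2 ^+ k.+1 * x.
Proof.
move=> x0 xy.
have ex : exists n, y < 2 ^+ n * x.
  exists (Num.bound (y / x)); rewrite -ltr_pdivrMr//.
  have y0 : 0 <= y / x by rewrite divr_ge0 ?ltW// (lt_le_trans x0).
  apply: lt_trans (archi_boundP y0) _.
  by rewrite -natrX ltr_nat ltn_expl.
case: (ex_minnP ex) => -[|k] hk hmin; first by move: hk; rewrite expr0 mul1r ltNge xy.
exists k; rewrite hk andbT leNgt; apply/negP => /hmin.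
by rewrite ltnn.
Qed.

End Integrals.

(** * Power integrals *)

Section PowerIntegrals.
Context {R : realType}.
Implicit Types (a b c m t x y : R).

Lemma le_powRN x y b : 0 < x -> x <= y -> 0 <= b -> y `^ (- b) <= x `^ (- b).
Proof.
move=> x0 xy b0; have y0 := lt_le_trans x0 xy.
rewrite !powRN lef_pV2 ?posrE ?powR_gt0// ge0_ler_powR// nnegrE ltW//.
Qed.

Lemma powRD_gt0 x a b : 0 < x -> x `^ (a + b) = x `^ a * x `^ b.
Proof. by move=> x0; rewrite powRD// (gt_eqF x0) implybT. Qed.

Lemma powR_pow2 a k : (2 ^+ k : R) `^ a = (2 `^ a) ^+ k.
Proof.
rewrite -powR_mulrn; last exact: ler0n.
rewrite -powRrM mulrC powRrM powR_mulrn//; exact: powR_ge0.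
Qed.

Lemma powR_div_pow2 a t k : 0 <= t -> (t / 2 ^+ k) `^ a = t `^ a * (2 `^ (- a)) ^+ k.
Proof.
move=> t0; rewrite powRM ?invr_ge0 ?exprn_ge0//; congr (_ * _).
by rewrite -powR_invn// -powRrM mulNr mulrC -mulNr powRrM powR_mulrn ?powR_ge0.
Qed.

Lemma powR2_lt1 a : a < 0 -> 0 <= (2 : R) `^ a < 1.
Proof.
move=> a0; rewrite powR_ge0/= -[a]opprK powRN invf_lt1 ?powR_gt0//.
have := @gt0_ltr_powR R (- a) _ 1 2; rewrite powR1; apply; rewrite ?nnegrE ?oppr_gt0//.
lra.
Qed.

Lemma itv_dist c t x : (`[c - t, c + t]%classic x) = (`|x - c| <= t) :> Prop.
Proof. by rewrite /= in_itv/= ler_distl. Qed.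

Lemma integral_near_le (D : set R) c t : measurable D -> 0 <= t ->
  (\int[lebesgue_measure]_(x in D) (1 * \1_(`[(c - t), (c + t)]%classic) x)%:E
    <= (2 * t)%:E)%E.
Proof.
move=> mD t0; under eq_integral do rewrite mul1r.
rewrite integral_indic//.
apply: (@le_trans _ _ (@lebesgue_measure R `[c - t, c + t]%classic)).
  by apply: le_measure; rewrite ?inE//; exact: measurableI.
rewrite lebesgue_measure_itv/=; case: ifP => _; last by rewrite lee_fin mulr_ge0.
by rewrite -EFinB lee_fin; lra.
Qed.

(** On the shell 2^k t <= max(t, |x - c|) < 2^(k+1) t the power is at most (2^k t)^(-b) and the mass
    of [w] at most A (2^(k+1) t)^m, so the ratio is 2^(m-b). The exponent [m] is free in order to
    serve the angle (m = 1) and the weighted radius (m = 1 + g). *)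
Lemma integral_max_power (D : set R) (w : R -> R) c t b m (A : R) : measurable D ->
  (forall x, D x -> 0 <= w x) -> measurable_fun D w -> 0 <= A -> 0 < t ->
  0 <= b -> m < b ->
  (forall s, 0 < s ->
    (\int[lebesgue_measure]_(x in D) (w x * \1_(`[(c - s), (c + s)]%classic) x)%:E
      <= (A * s `^ m)%:E)%E) ->
  (\int[lebesgue_measure]_(x in D) (w x * Num.max t `|x - c| `^ (- b))%:E
    <= (A * 2 `^ m / (1 - 2 `^ (m - b)) * t `^ (m - b))%:E)%E.
Proof.
move=> mD w0 mw A0 t0 b0 mb hA.
rewrite mulrAC.
have tk k : 0 < 2 ^+ k * t by rewrite mulr_gt0.
apply: (@integral_le_geometric R _ _ lebesgue_measure D mD _ w
  (fun k => (2 ^+ k * t) `^ (- b)) (fun k => A * (2 ^+ k.+1 * t) `^ m)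
  (fun k => `[c - 2 ^+ k.+1 * t, c + 2 ^+ k.+1 * t]%classic)) => //.
- by move=> x Dx; rewrite lee_fin mulr_ge0 ?w0 ?powR_ge0.
- by move=> k; exact: powR_ge0.
- by rewrite !mulr_ge0 ?powR_ge0.
- by apply: powR2_lt1; lra.
- move=> x Dx _.
  have [k /andP[k1 k2]] : exists k, 2 ^+ k * t <= Num.max t `|x - c| < 2 ^+ k.+1 * t.
    by apply: dyadic_bracket => //; rewrite le_max lexx.
  exists k; first by rewrite itv_dist; apply: le_trans (ltW k2); rewrite le_max lexx orbT.
  by rewrite lee_fin mulrC ler_wpM2r ?w0// le_powRN.
- by move=> k; exact: hA.
- move=> k; rewrite le_eqVlt; apply/orP; left; apply/eqP.
  have t1 := ltW t0; have p2 n : 0 <= (2 : R) ^+ n by [].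
  rewrite !powRM//.
  rewrite !powR_pow2 !(powRD_gt0 m (- b))//.
  by rewrite exprS exprMn; ring.
Qed.

(** Here the shells t/2^(k+1) < 1 - x <= t/2^k shrink towards the singularity at 1. The k-th has
    length at most 2t/2^k, so the ratio is 2^(-(1+g)), below one since g > -1. *)
Lemma integral_power_near_le (g t : R) : -1 < g < 0 -> 0 < t ->
  (\int[lebesgue_measure]_(x in `]0%R, 1%R[)
     ((1 - x) `^ g * \1_(`[(1 - t), (1 + t)]%classic) x)%:E
    <= (2 * 2 `^ (- g) / (1 - 2 `^ (- (1 + g))) * t `^ (1 + g))%:E)%E.
Proof.
move=> /andP[g1 g0] t0.
rewrite mulrAC.
have tk k : 0 < t / 2 ^+ k by rewrite divr_gt0.
apply: (@integral_le_geometric R _ _ lebesgue_measure _ _ _ (fun=> 1)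
  (fun k => (t / 2 ^+ k.+1) `^ g) (fun k => 2 * (t / 2 ^+ k))
  (fun k => `[1 - t / 2 ^+ k, 1 + t / 2 ^+ k]%classic)) => //.
- by move=> x _; rewrite lee_fin mulr_ge0 ?powR_ge0// indicE.
- by move=> k; exact: powR_ge0.
- by rewrite !mulr_ge0 ?powR_ge0.
- by apply: powR2_lt1; lra.
- move=> x; rewrite /= in_itv/= => /andP[x0 x1].
  rewrite lte_fin indicE; case: (boolP (x \in _)) => [xt _|_]; last by rewrite mulr0 ltxx.
  have {}xt : 1 - x <= t.
    by move: xt; rewrite inE itv_dist ler0_norm; lra.
  have x10 : 0 < 1 - x by lra.
  have [k /andP[k1 k2]] := dyadic_bracket x10 xt.
  have p2 n : 0 < (2 : R) ^+ n by [].
  exists k.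
    by rewrite in_itv/= -ler_distl ler0_norm ?ler_pdivlMr//; lra.
  rewrite lee_fin mulr1 -[g]opprK mulr1 le_powRN//; last lra.
  by rewrite ler_pdivrMr// mulrC ltW.
- by move=> k; apply: integral_near_le => //; exact: ltW.
- move=> k; rewrite le_eqVlt; apply/orP; left; apply/eqP.
  rewrite powR_div_pow2 ?ltW// (powRD_gt0 1 g t0) powRr1 ?ltW//.
  rewrite opprD (powRD_gt0 (-1) (- g))// powR_inv1//.
  by rewrite exprS exprMn exprVn; ring.
Qed.

End PowerIntegrals.

(** * Distance estimates in polar coordinates *)

Section PolarGeometry.
Local Open Scope complex_scope.
Context {R : realType}.
Implicit Types (x s t c r : R).

(** A Jordan inequality with a cheap constant: on [0, 1] the mean value theorem gives sin y >= y cos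
    1; beyond 1, monotonicity gives sin x >= sin 1 >= cos 1, and x <= pi/2 < 2. *)
Lemma sin_ge_lin x : 0 <= x <= pi / 2 -> cos 1 / 2 * x <= sin x.
Proof.
move=> /andP[x0 x2].
have pi2 : pi < 4 :> R by have /andP[_] := @pihalf_02 R; lra.
have pi1 : 2 <= pi :> R := pi_ge2 R.
have small (y : R) : 0 <= y <= 1 -> cos 1 * y <= sin y.
  move=> /andP[y0 y1].
  have [c] := @MVT_segment R sin cos 0 y y0 (fun z _ => is_derive_sin z)
    (continuous_subspaceT (@continuous_sin R)).
  rewrite in_itv/= sin0 !subr0 => /andP[c0 cy] ->.
  rewrite ler_wpM2r//.
  have [->//|c1] := eqVneq c 1.
  by rewrite ltW// ltr_cos ?in_itv/=; lra.
have c1 : 0 < cos 1 :> R := cos1_gt0 R.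
have [x1|x1] := leP x 1.
  by apply: le_trans (small x _); [nra|rewrite x0].
apply: (@le_trans _ _ (sin 1)); last by rewrite ltW// ltr_sin ?in_itv/=; lra.
by apply: (@le_trans _ _ (cos 1 * 1)); [nra|apply: small; rewrite ler01 lexx].
Qed.

Lemma normr_sin_ge x : `|x| <= pi / 2 -> cos 1 / 2 * `|x| <= `|sin x|.
Proof.
move=> xp; have h : cos 1 / 2 * `|x| <= sin `|x| by apply: sin_ge_lin; rewrite normr_ge0.
apply: le_trans h _; have [x0|x0] := leP 0 x; first by rewrite ger0_norm// ler_norm.
by rewrite ltr0_norm// sinN -normrN ler_norm.
Qed.

(** Normalises the arguments of the zeros, so that only two translates of each can be closest to an
    angle in [0, 2 pi]. *)
Lemma polarC_arg r t : exists2 c, - pi <= c <= pi & polarC r t = polarC r c.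
Proof.
have c1 : -1 <= cos t <= 1 by rewrite cos_geN1 cos_le1.
have /andP[a0 api] := (acos_def c1).1.
have ca : cos (acos (cos t)) = cos t := (acos_def c1).2.
have sa : sin (acos (cos t)) = `|sin t|.
  by rewrite sin_acos// -sqrtr_sqr sin2cos2.
have [s0|s0] := leP 0 (sin t).
  exists (acos (cos t)); first by apply/andP; split; lra.
  by rewrite /polarC ca sa ger0_norm.
exists (- acos (cos t)); first by apply/andP; split; lra.
by rewrite /polarC cosN sinN ca sa ltr0_norm// opprK.
Qed.

Lemma normc_polarC r t : 0 <= r -> normc (polarC r t) = r.
Proof.
move=> r0; rewrite /polarC /normc !exprMn -mulrDr cos2Dsin2 mulr1 sqrtr_sqr.
exact: ger0_norm.
Qed.

Lemma sqr_normc_polar_den (r1 r2 c t : R) :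
  normc (1 - (polarC r1 c)^*%C * polarC r2 t) ^+ 2 =
  (1 - r1 * r2) ^+ 2 + 4 * (r1 * r2) * sin ((t - c) / 2) ^+ 2.
Proof.
have -> : 1 - (polarC r1 c)^*%C * polarC r2 t =
  (1 - r1 * r2 * cos (t - c)) +i* (- (r1 * r2 * sin (t - c))) :> R[i].
  by apply/eqP; rewrite eq_complex /= cosB sinB; apply/andP; split; apply/eqP; ring.
rewrite sqr_normcE.
have e : cos (t - c) = 1 - 2 * sin ((t - c) / 2) ^+ 2.
  rewrite [in LHS](_ : t - c = (t - c) / 2 *+ 2); last by rewrite mulr2n; lra.
  rewrite cos_mulr2n mulr2n.
  by have := cos2Dsin2 ((t - c) / 2); lra.
have := cos2Dsin2 (t - c); rewrite e; set S := sin ((t - c) / 2).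
set U := sin (t - c) => h.
have -> : (1 - r1 * r2 * (1 - 2 * S ^+ 2)) ^+ 2 + (- (r1 * r2 * U)) ^+ 2 =
  1 - 2 * (r1 * r2 * (1 - 2 * S ^+ 2)) +
  (r1 * r2) ^+ 2 * ((1 - 2 * S ^+ 2) ^+ 2 + U ^+ 2) by ring.
by rewrite h; ring.
Qed.

(** As t - c lies in [-pi, 3 pi], either [c] or [c + 2 * pi] is within pi of [t]; at that one the
    half-angle is in the range of the linear bound for sine. The constant is cos 1 / 2 halved by the
    half-angle. *)
Lemma normc_polar_den_ge (r1 r2 c t : R) : 0 <= r1 * r2 <= 1 ->
  - pi <= c <= pi -> 0 <= t <= 2 * pi ->
  cos 1 / 4 * Num.max (1 - r1 * r2) `|t - c| <= normc (1 - (polarC r1 c)^*%C * polarC r2 t) \/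
  cos 1 / 4 * Num.max (1 - r1 * r2) `|t - (c + 2 * pi)|
    <= normc (1 - (polarC r1 c)^*%C * polarC r2 t).
Proof.
set s := r1 * r2 => /andP[s0 s1] /andP[c1 c2] /andP[t1 t2].
have p0 : 0 < pi :> R := pi_gt0 R.
have k0 : 0 < cos 1 :> R := cos1_gt0 R.
have k1 : cos 1 <= 1 :> R := cos_le1 1.
set N := normc _.
have N0 : 0 <= N := normc_ge0 _.
have N2 : N ^+ 2 = (1 - s) ^+ 2 + 4 * s * sin ((t - c) / 2) ^+ 2.
  exact: sqr_normc_polar_den.
have S1 : sin ((t - c) / 2) ^+ 2 <= 1 by have := cos2Dsin2 ((t - c) / 2); nra.
have Ns : 1 - s <= N.
  rewrite -(@ler_pXn2r _ 2) ?nnegrE ?subr_ge0// N2 lerDl.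
  by apply: mulr_ge0; [apply: mulr_ge0|exact: sqr_ge0].
have NS : `|sin ((t - c) / 2)| <= N.
  rewrite -(@ler_pXn2r _ 2) ?nnegrE// real_normK ?num_real// N2.
  move: S1 (sqr_ge0 (sin ((t - c) / 2))); set S := sin _ ^+ 2 => S1 S0.
  rewrite -subr_ge0.
  (* This form is visibly nonnegative for S in [0, 1], so |sin| <= N holds even when s is near 0 and
     the sine term of N^2 is lost. *)
  have -> : (1 - s) ^+ 2 + 4 * s * S - S = (1 - S) * (1 - s) ^+ 2 + S * (s * (2 + s)).
    by ring.
  by rewrite addr_ge0// mulr_ge0 ?sqr_ge0 ?subr_ge0// mulr_ge0// addr_ge0.
have key (y : R) : cos 1 / 4 * `|y| <= N -> cos 1 / 4 * Num.max (1 - s) `|y| <= N.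
  move=> hy; rewrite maxr_pMr; last by lra.
  by rewrite ge_max hy andbT; nra.
have [small|big] := leP ((t - c) / 2) (pi / 2).
  left; apply: key; apply: le_trans NS.
  have h : `|(t - c) / 2| <= pi / 2 by rewrite ler_norml; apply/andP; split; lra.
  by apply: le_trans (normr_sin_ge h); rewrite normrM [X in _ * (_ * X)]ger0_norm; lra.
right; apply: key; apply: le_trans NS.
have -> : sin ((t - c) / 2) = - sin ((t - (c + 2 * pi)) / 2).
  rewrite (_ : (t - c) / 2 = (t - (c + 2 * pi)) / 2 + pi); last by lra.
  by rewrite sinD sinpi cospi; ring.
rewrite normrN.
have h : `|(t - (c + 2 * pi)) / 2| <= pi / 2.
  by rewrite ler_norml; apply/andP; split; lra.
apply: le_trans (normr_sin_ge h); rewrite normrM [X in _ * (_ * X)]ger0_norm; lra.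
Qed.

End PolarGeometry.

(** * Powers of the derivative *)

Section PowerSums.
Local Open Scope complex_scope.
Context {R : realType}.
Implicit Types (x y q : R).

(** Each share v = u/(x + y) lies in [0, 1] and so satisfies v <= v^q; the two shares add up to
    one. *)
Lemma powR_add_le x y q : 0 <= x -> 0 <= y -> 0 < q <= 1 ->
  (x + y) `^ q <= x `^ q + y `^ q.
Proof.
move=> x0 y0 /andP[q0 q1].
have [xy|xy] := leP (x + y) 0.
  have -> : x + y = 0 by apply/eqP; rewrite eq_le xy addr_ge0.
  by rewrite powR0 ?gt_eqF// addr_ge0 ?powR_ge0.
have h u : 0 <= u -> u <= x + y -> (x + y) `^ q * (u / (x + y)) <= u `^ q.
  rewrite le_eqVlt => /orP[/eqP <-|u0] uxy; first by rewrite mul0r mulr0 powR_ge0.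
  have e : u = (x + y) * (u / (x + y)) by field; rewrite gt_eqF.
  have v0 : 0 < u / (x + y) by rewrite divr_gt0.
  rewrite [in leRHS]e powRM; [|exact: ltW|exact: ltW].
  rewrite ler_wpM2l ?powR_ge0//.
  by apply: ger1_powR => //; rewrite v0/= ler_pdivrMr// mul1r.
have := lerD (h x x0 _) (h y y0 _); rewrite -mulrDr -mulrDl divff ?gt_eqF// mulr1.
by apply; rewrite ?lerDl ?lerDr.
Qed.

Lemma powR_sum_le (a : nat -> R) q N : (forall n, 0 <= a n) -> 0 < q <= 1 ->
  (\sum_(n < N) a n) `^ q <= \sum_(n < N) (a n) `^ q.
Proof.
move=> a0 q01; elim: N => [|N IH].
  by rewrite !big_ord0 powR0// gt_eqF//; case/andP: q01.
rewrite !big_ord_recr/=; apply: le_trans (powR_add_le _ _ q01) _ => //.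
  exact: sumr_ge0.
by rewrite lerD2r.
Qed.

Lemma measurable_max_power (D : set R) (d c b : R) :
  measurable_fun D (fun x => Num.max d `|x - c| `^ b).
Proof.
apply: (measurableT_comp (f := fun x => x `^ b)); first exact: measurable_powR.
apply: measurable_maxr => //.
apply: measurableT_comp; first exact: normr_measurable.
exact: measurable_funB.
Qed.

(** The two summands are the peaks at the two representatives of the argument, whence the extra
    factor 2. *)
Lemma theta_integral_le (k d c b : R) : 0 <= k -> 0 < d -> 1 < b ->
  (\int[lebesgue_measure]_(x in `[0%R, (2 * pi)%R])
     (k * (Num.max d `|x - c| `^ (- b) + Num.max d `|x - (c + 2 * pi)| `^ (- b)))%:E
   <= (k * (2 * (2 * 2 `^ 1 / (1 - 2 `^ (1 - b)))) * d `^ (1 - b))%:E)%E.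
Proof.
move=> k0 d0 b1.
have one e : (\int[lebesgue_measure]_(x in `[0%R, (2 * pi)%R])
     (Num.max d `|x - e| `^ (- b))%:E
   <= (2 * 2 `^ 1 / (1 - 2 `^ (1 - b)) * d `^ (1 - b))%:E)%E.
  under eq_integral do rewrite -[X in X%:E]mul1r.
  apply: (@integral_max_power R _ (fun=> 1)) => //; first lra.
  by move=> s /ltW s0; rewrite powRr1//; exact: integral_near_le.
have mf e : measurable_fun `[0, 2 * pi] (fun x : R => (Num.max d `|x - e| `^ (- b))%:E).
  by apply/measurable_EFinP; exact: measurable_max_power.
have f0 (e : R) (x : R) : (0 <= (Num.max d `|x - e| `^ (- b))%:E)%E.
  by rewrite lee_fin powR_ge0.
under eq_integral do rewrite EFinM EFinD.
rewrite ge0_integralZl//=; first last.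
- by move=> x _; rewrite adde_ge0.
- by apply: emeasurable_funD; exact: mf.
rewrite ge0_integralD//=; [|exact: mf|exact: mf].
set C := 2 * 2 `^ 1 / (1 - 2 `^ (1 - b)) in one *.
apply: (@le_trans _ _ (k%:E * (2 * C * d `^ (1 - b))%:E)%E).
  apply: lee_wpmul2l; first by rewrite lee_fin.
  apply: le_trans (leeD (one _) (one _)) _.
  by rewrite -EFinD lee_fin; lra.
by rewrite -EFinM lee_fin le_eqVlt; apply/orP; left; apply/eqP; ring.
Qed.

(** The constant of [integral_max_power] for m = 1 + g, with the constant of
    [integral_power_near_le] as [A]. *)
Definition rho_const (g b : R) : R :=
  2 * 2 `^ (- g) / (1 - 2 `^ (- (1 + g))) * 2 `^ (1 + g) / (1 - 2 `^ (1 + g - b)).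

Lemma rho_integral_le (k d g b : R) : 0 <= k -> 0 < d -> -1 < g < 0 -> 1 + g < b ->
  (\int[lebesgue_measure]_(x in `]0%R, 1%R[)
     (k * ((1 - x) `^ g * Num.max d `|x - 1| `^ (- b)))%:E
   <= (k * rho_const g b * d `^ (1 + g - b))%:E)%E.
Proof.
move=> k0 d0 g01 gb; have /andP[g1 g0] := g01.
have mw : measurable_fun (`]0, 1[%classic : set R) (fun x : R => (1 - x) `^ g).
  apply: (measurableT_comp (f := fun x => x `^ g)); first exact: measurable_powR.
  exact: measurable_funB.
under eq_integral do rewrite EFinM.
rewrite ge0_integralZl//=; first last.
- by move=> x _; rewrite lee_fin mulr_ge0 ?powR_ge0.
- by apply/measurable_EFinP; apply: measurable_funM => //; exact: measurable_max_power.
apply: (@le_trans _ _ (k%:E * (rho_const g b * d `^ (1 + g - b))%:E)%E); last first.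
  by rewrite -EFinM lee_fin le_eqVlt; apply/orP; left; apply/eqP; ring.
apply: lee_wpmul2l; first by rewrite lee_fin.
apply: (@integral_max_power R _ (fun x => (1 - x) `^ g)) => //.
- by move=> x _; rewrite powR_ge0.
- have /andP[_ h] : 0 <= (2 : R) `^ (- (1 + g)) < 1 by apply: powR2_lt1; lra.
  by rewrite divr_ge0 ?mulr_ge0 ?powR_ge0//; lra.
- lra.
- by move=> s s0; exact: integral_power_near_le.
Qed.

End PowerSums.

Section DerivativePowers.
Local Open Scope complex_scope.
Context {R : realType}.
Variable z : nat -> R[i].
Hypothesis zB : blaschke_sequence z.

Let dB w : R[i] := derive1 (blaschke_product z : R[i] -> R[i]^o) w.

Lemma derive1_blaschke_powR_le w (q : R) : normc w < 1 -> 0 < q <= 1 ->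
  ((normc (dB w) `^ q)%:E <=
   \sum_(0 <= n <oo) ((4 * ((1 - normc (z n)) / normc (1 - (z n)^*%C * w) ^+ 2)) `^ q)%:E)%E.
Proof.
move=> w1 q01; have /andP[q0 q1] := q01.
set a := fun n => (1 - normc (z n)) / normc (1 - (z n)^*%C * w) ^+ 2.
rewrite -/(\sum_(0 <= n <oo) ((4 * a n) `^ q)%:E)%E.
have a0 n : 0 <= a n.
  by rewrite divr_ge0 ?exprn_ge0 ?normc_ge0// subr_ge0; have /andP[_ /ltW] := zB.1 n.
set T := (\sum_(0 <= n <oo) _)%E.
have T0 N : ((\sum_(n < N) (4 * a n) `^ q)%:E <= T)%E.
  have := @nneseries_lim_ge R (fun n => ((4 * a n) `^ q)%:E) xpredT 0%N N.
  rewrite sumEFin big_mkord; apply=> n _ _; by rewrite lee_fin powR_ge0.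
(* An infinite sum bounds anything, and -oo contradicts the empty partial sum; only a real value [x]
   remains. *)
case: T T0 => [x||] T0; [|by rewrite leey|by have := T0 0%N].
have x0 : 0 <= x by have := T0 0%N; rewrite big_ord0 lee_fin.
rewrite lee_fin.
(* By subadditivity of the q-th power, the partial sums of the 4 a_n are at most x^(1/q), so
   x^(1/q)/4 bounds those of the a_n. *)
have h : normc (dB w) <= x `^ q^-1.
  have -> : x `^ q^-1 = 4 * (x `^ q^-1 / 4) by field.
  apply: derive1_blaschke_le_sum => // N.
  rewrite -/(a _) ler_pdivlMr// mulrC mulr_sumr.
  have := T0 N; rewrite lee_fin => TN.
  have S0 : 0 <= \sum_(n < N) 4 * a n by apply: sumr_ge0 => n _; rewrite mulr_ge0.
  have -> : \sum_(n < N) 4 * a n = ((\sum_(n < N) 4 * a n) `^ q) `^ q^-1.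
    by rewrite -powRrM divff ?gt_eqF// powRr1.
  apply: ge0_ler_powR; rewrite ?nnegrE ?invr_ge0 ?powR_ge0//; first exact: ltW.
  apply: le_trans _ TN; apply: (powR_sum_le (a := fun n => 4 * a n)) => // n.
  by rewrite mulr_ge0.
have := ge0_ler_powR (ltW q0) _ _ h; rewrite -powRrM mulVf ?gt_eqF// powRr1//.
by apply; rewrite nnegrE ?normc_ge0 ?powR_ge0.
Qed.

End DerivativePowers.

(** * The weighted mean *)

Section MainEstimate.
Local Open Scope complex_scope.
Context {R : realType}.

Lemma term_powR_le (q d N k M : R) : 0 < q -> 0 <= d -> 0 < k -> 0 < M -> k * M <= N ->
  (4 * (d / N ^+ 2)) `^ q <= 4 `^ q * k `^ (- (2 * q)) * d `^ q * M `^ (- (2 * q)).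
Proof.
move=> q0 d0 k0 M0 kMN.
have kM0 : 0 < k * M by rewrite mulr_gt0.
have N0 := lt_le_trans kM0 kMN.
apply: (@le_trans _ _ ((4 * (d / (k * M) ^+ 2)) `^ q)).
  apply: ge0_ler_powR; [exact: ltW| | |].
  - by rewrite nnegrE mulr_ge0// divr_ge0// exprn_ge0// ltW.
  - by rewrite nnegrE mulr_ge0// divr_ge0// exprn_ge0// ltW.
  rewrite ler_wpM2l// ler_wpM2l// lef_pV2 ?posrE ?exprn_gt0//.
  by rewrite ler_pXn2r// nnegrE ltW.
have kM1 := ltW kM0; have k1 := ltW k0; have M1 := ltW M0.
rewrite powRM//; last by rewrite divr_ge0// exprn_ge0.
rewrite powRM ?invr_ge0 ?exprn_ge0// -(powR_invn 2 kM1) -powRrM mulNr powRM//.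
by rewrite le_eqVlt; apply/orP; left; apply/eqP; ring.
Qed.

Lemma powR_le_split (x B p q : R) : 0 <= x <= B -> 0 < q <= p ->
  x `^ p <= B `^ (p - q) * x `^ q.
Proof.
move=> /andP[]; rewrite le_eqVlt => /orP[/eqP <- _|x0 xB] /andP[q0 qp].
  by rewrite !powR0 ?gt_eqF ?mulr0//; exact: lt_le_trans qp.
have -> : x `^ p = x `^ (p - q) * x `^ q by rewrite -powRD_gt0// subrK.
rewrite ler_wpM2r ?powR_ge0//.
apply: ge0_ler_powR => //; rewrite ?subr_ge0// nnegrE ltW//.
exact: lt_le_trans xB.
Qed.

Variables (z : nat -> R[i]) (rad theta : nat -> R).
Hypothesis rad01 : forall n, 0 < rad n < 1.
Hypothesis z_polar : forall n, z n = polarC (rad n) (theta n).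
Hypothesis zB : blaschke_sequence z.
Variables (g q p : R).
Hypothesis g01 : -1 < g < 0.
Hypothesis q01 : 1 + g / 2 < q <= 1.
Hypothesis qp : q <= p.

(** The angular integral turns the exponent -2q of the denominator into 1 - 2q and the radial one
    adds 1 + g. They need 2q > 1 and 2q - 1 > 1 + g, both consequences of q > 1 + g/2 and g > -1. *)
Lemma weighted_mean_le : exists2 C : R, 0 < C & forall r, 0 < r < 1 ->
  (weighted_mean_integral (blaschke_product z) p g r <=
   \sum_(0 <= n <oo) (C * (1 - r) `^ (- (p - q)) *
     ((1 - rad n) `^ q * (1 - rad n * r) `^ (2 + g - 2 * q)))%:E)%E.
Proof.
have /andP[g1 g0] := g01; have /andP[q1 q2] := q01.
have [c cpi zc] : exists2 c : nat -> R, (forall n, - pi <= c n <= pi) &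
    forall n, z n = polarC (rad n) (c n).
  have /choice[c hc] : forall n, exists c, - pi <= c <= pi /\ z n = polarC (rad n) c.
    by move=> n; have [c c1 c2] := polarC_arg (rad n) (theta n); exists c; rewrite z_polar.
  by exists c => n; have [] := hc n.
have radz n : normc (z n) = rad n.
  by rewrite zc normc_polarC//; have /andP[/ltW] := rad01 n.
set k : R := cos 1 / 4.
have k0 : 0 < k by rewrite divr_gt0// cos1_gt0.
set K1 := 4 `^ q * k `^ (- (2 * q)).
set K0 : R := 2 `^ (p - q).
set CT : R := 2 * (2 * 2 `^ 1 / (1 - 2 `^ (1 - 2 * q))).
set CR : R := rho_const g (2 * q - 1).
have K10 : 0 < K1 by rewrite mulr_gt0 ?powR_gt0.
have K00 : 0 < K0 by rewrite powR_gt0.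
have CT0 : 0 < CT.
  have /andP[_ h] : 0 <= (2 : R) `^ (1 - 2 * q) < 1 by apply: powR2_lt1; lra.
  by rewrite mulr_gt0// divr_gt0 ?mulr_gt0 ?powR_gt0//; lra.
have CR0 : 0 < CR.
  have /andP[_ h1] : 0 <= (2 : R) `^ (- (1 + g)) < 1 by apply: powR2_lt1; lra.
  have /andP[_ h2] : 0 <= (2 : R) `^ (1 + g - (2 * q - 1)) < 1 by apply: powR2_lt1; lra.
  rewrite /CR /rho_const divr_gt0 ?subr_gt0// mulr_gt0 ?powR_gt0//.
  by rewrite divr_gt0 ?subr_gt0// mulr_gt0 ?powR_gt0.
exists (K0 * K1 * CT * CR).
  by apply: mulr_gt0 => //; apply: mulr_gt0 => //; apply: mulr_gt0.
move=> r /andP[r0 r1].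
have r1' : 0 < 1 - r by lra.
set T := (1 - r) `^ (- (p - q)).
have T0 : 0 < T by rewrite powR_gt0.
set D := fun n => (1 - rad n) `^ q.
have D0 n : 0 <= D n by exact: powR_ge0.
have d0 n : 0 <= 1 - rad n by have /andP[_ /ltW] := rad01 n; rewrite subr_ge0.
have k1 n x : 0 <= K0 * T * (1 - x) `^ g * K1 * D n.
  apply: mulr_ge0 (D0 n); apply: mulr_ge0 (ltW K10).
  exact: mulr_ge0 (mulr_ge0 (ltW K00) (ltW T0)) (powR_ge0 _ _).
have s01 n x : 0 < x < 1 -> 0 <= rad n * (r * x) < 1.
  move=> /andP[x0 x1]; have /andP[u0 u1] := rad01 n.
  have rx0 : 0 < r * x by exact: mulr_gt0.
  have rx1 : r * x < 1 by nra.
  by apply/andP; split; nra.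
(* Angular integral at a fixed radius [x]. *)
have inner x : 0 < x < 1 ->
  (\int[lebesgue_measure]_(t in `[0%R, (2 * pi)%R])
     (normc (derive1 (blaschke_product z : R[i] -> R[i]^o) (polarC (r * x) t) : R[i]) `^ p
       * (x * (1 - x ^+ 2) `^ g))%:E <=
   \sum_(0 <= n <oo) (K0 * T * (1 - x) `^ g * K1 * D n * CT *
      (1 - rad n * (r * x)) `^ (1 - 2 * q))%:E)%E.
  move=> x01; have /andP[x0 x1] := x01.
  have rx1 : r * x < r by rewrite gtr_pMr.
  have W : x * (1 - x ^+ 2) `^ g <= (1 - x) `^ g.
    rewrite -[leRHS]mul1r; apply: ler_pM; [exact: ltW|exact: powR_ge0|exact: ltW|].
    by rewrite -[g]opprK; apply: le_powRN; [lra|nra|lra].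
  have W0 : 0 <= x * (1 - x ^+ 2) `^ g by rewrite mulr_ge0 ?powR_ge0// ltW.
  have nw t : normc (polarC (r * x) t) = r * x.
    by rewrite normc_polarC//; apply: mulr_ge0; exact: ltW.
  (* The sum of both peaks dominates whichever alternative of [normc_polar_den_ge] occurs at [t]. *)
  pose G n t := K0 * T * (1 - x) `^ g * K1 * D n *
    (Num.max (1 - rad n * (r * x)) `|t - c n| `^ (- (2 * q)) +
     Num.max (1 - rad n * (r * x)) `|t - (c n + 2 * pi)| `^ (- (2 * q))).
  have G0 n t : 0 <= G n t.
    by apply: mulr_ge0 (k1 n x) _; apply: addr_ge0; exact: powR_ge0.
  apply: (@integral_le_nneseries R _ _ lebesgue_measure _ _ _ G) => //.
  - by move=> t _; rewrite lee_fin mulr_ge0 ?powR_ge0.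
  - move=> n; apply: measurable_funM => //.
    by apply: measurable_funD; exact: measurable_max_power.
  - move=> t; rewrite /= in_itv/= => /andP[t0 t1].
    set w := polarC (r * x) t; set B := normc _.
    have w1 : normc w < 1 by rewrite nw; lra.
    have B1 : B <= 2 / (1 - r).
      apply: le_trans (derive1_blaschke_le zB w1) _.
      by rewrite ler_wpM2l// lef_pV2 ?posrE// nw; lra.
    have B0 : 0 <= B by exact: normc_ge0.
    (* The Schwarz-Pick bound is spent on the surplus exponent p - q only; since |w| = r x <= r, it
       is uniform in [x] and [t]. *)
    have Bp : B `^ p <= K0 * T * B `^ q.
      have -> : K0 * T = (2 / (1 - r)) `^ (p - q).
        rewrite powRM ?invr_ge0 ?ltW// /T powRN.
        by rewrite -[in RHS]powR_inv1 ?ltW// -powRrM mulN1r powRN.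
      by apply: powR_le_split; rewrite ?B0 ?qp ?andbT//; lra.
    apply: (@le_trans _ _ ((K0 * T * (1 - x) `^ g)%:E * (B `^ q)%:E)%E).
      rewrite -EFinM lee_fin [leRHS]mulrAC.
      by rewrite ler_pM ?powR_ge0.
    apply: (@le_trans _ _ ((K0 * T * (1 - x) `^ g)%:E * \sum_(0 <= n <oo)
       ((4 * ((1 - normc (z n)) / normc (1 - (z n)^*%C * w) ^+ 2)) `^ q)%:E)%E).
      apply: lee_wpmul2l.
        by rewrite lee_fin; apply: mulr_ge0 (powR_ge0 _ _); apply: mulr_ge0; exact: ltW.
      by apply: derive1_blaschke_powR_le => //; apply/andP; split; lra.
    rewrite -nneseriesZl; last by move=> n _; rewrite lee_fin powR_ge0.
    apply: lee_nneseries => [n _ _|n _].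
      rewrite -EFinM lee_fin; apply: mulr_ge0 (powR_ge0 _ _).
      by apply: mulr_ge0 (powR_ge0 _ _); apply: mulr_ge0; exact: ltW.
    rewrite -EFinM lee_fin.
    have /andP[s0 s1] := s01 n x x01.
    have M0 y : 0 < Num.max (1 - rad n * (r * x)) y by rewrite lt_max subr_gt0 s1.
    rewrite /G -[leRHS]mulrA -[leRHS]mulrA; apply: ler_wpM2l.
      by apply: mulr_ge0 (powR_ge0 _ _); apply: mulr_ge0; exact: ltW.
    rewrite radz [leRHS]mulrA mulrDr.
    have q0 : 0 < q by lra.
    have s1' := ltW s1.
    have s01' : 0 <= rad n * (r * x) <= 1 by rewrite s0.
    have t01' : 0 <= t <= 2 * pi by rewrite t0.
    have [h|h] := normc_polar_den_ge s01' (cpi n) t01'; rewrite -zc -/w in h.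
      apply: le_trans (term_powR_le q0 (d0 n) k0 (M0 _) h) _.
      by rewrite lerDl; apply: mulr_ge0 (powR_ge0 _ _); apply: mulr_ge0 (D0 n); exact: ltW.
    apply: le_trans (term_powR_le q0 (d0 n) k0 (M0 _) h) _.
    by rewrite lerDr; apply: mulr_ge0 (powR_ge0 _ _); apply: mulr_ge0 (D0 n); exact: ltW.
  - move=> n; have /andP[s0 s1] := s01 n x x01.
    have := theta_integral_le (c n) (k1 n x) (d := 1 - rad n * (r * x)) (b := 2 * q).
    by apply; [rewrite subr_gt0|lra].
have k2 n : 0 <= K0 * T * K1 * D n * CT.
  apply: mulr_ge0 (ltW CT0); apply: mulr_ge0 (D0 n); apply: mulr_ge0 (ltW K10).
  by apply: mulr_ge0; exact: ltW.
pose H n x := K0 * T * K1 * D n * CT *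
  ((1 - x) `^ g * Num.max (1 - rad n * r) `|x - 1| `^ (- (2 * q - 1))).
have H0 n x : 0 <= H n x.
  by apply: mulr_ge0 (k2 n) _; apply: mulr_ge0; exact: powR_ge0.
apply: (@integral_le_nneseries R _ _ lebesgue_measure _ _ _ H) => //.
- move=> x; rewrite /= in_itv/= => /andP[x0 x1].
  apply: integral_ge0 => t _; rewrite lee_fin; apply: mulr_ge0 (powR_ge0 _ _) _.
  by apply: mulr_ge0 (powR_ge0 _ _); exact: ltW.
- move=> n; apply: measurable_funM => //; apply: measurable_funM.
    apply: (measurableT_comp (f := fun x => x `^ g)); first exact: measurable_powR.
    exact: measurable_funB.
  exact: measurable_max_power.
- move=> x; rewrite /= in_itv/= => x01; apply: le_trans (inner x x01) _.
  have /andP[x0 x1] := x01.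
  apply: lee_nneseries => [n _ _|n _]; rewrite lee_fin.
    by apply: mulr_ge0 (powR_ge0 _ _); apply: mulr_ge0 (k1 n x) (ltW CT0).
  have e : K0 * T * (1 - x) `^ g * K1 * D n * CT = K0 * T * K1 * D n * CT * (1 - x) `^ g.
    by ring.
  rewrite e /H -[leLHS]mulrA; apply: ler_wpM2l => //.
  apply: ler_wpM2l; first exact: powR_ge0.
  have /andP[u0 u1] := rad01 n.
  (* 1 - rad n * (r x) dominates both 1 - rad n * r and 1 - x, hence their maximum, and the exponent
     1 - 2q is negative. *)
  rewrite -[1 - 2 * q]opprB; apply: le_powRN; last by lra.
    by rewrite lt_max subr_gt0; apply/orP; left; nra.
  rewrite ge_max ler0_norm; last by lra.
  have rr0 : 0 < rad n * r by exact: mulr_gt0.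
  have rr1 : rad n * r < 1 by nra.
  rewrite !mulrA; set v := rad n * r in rr0 rr1 *.
  by apply/andP; split; nra.
- move=> n; have /andP[u0 u1] := rad01 n.
  have dr : 0 < 1 - rad n * r by rewrite subr_gt0; nra.
  apply: le_trans (rho_integral_le (k2 n) dr g01 _) _; first by lra.
  rewrite lee_fin le_eqVlt; apply/orP; left; apply/eqP.
  have -> : 1 + g - (2 * q - 1) = 2 + g - 2 * q by ring.
  by rewrite /T /D /CR; ring.
Qed.
End MainEstimate.

(** * Comparison with h *)

Section ZeroTerms.
Context {R : realType}.

(** Quantitative form of dominated convergence: the first [N] terms are kept, and the rest is
    bounded by a tail of [u] that does not see any parameter hidden in [A]. *)
Lemma nneseries_le_head_tail (A u : nat -> R) N :
  (forall n, 0 <= A n <= u n) -> cvgn (series u) ->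
  (\sum_(0 <= n <oo) (A n)%:E <=
   (\sum_(n < N) A n + (limn (series u) - series u N))%:E)%E.
Proof.
move=> Au cu.
have A0 n : 0 <= A n by have /andP[] := Au n.
have u0 n : 0 <= u n by have /andP[a0 /(le_trans a0)] := Au n.
apply: lime_le.
  by apply: is_cvg_nneseries => n _ _; rewrite lee_fin.
near=> k.
rewrite sumEFin lee_fin.
apply: (@le_trans _ _ (\sum_(0 <= n < N + k) A n)).
  rewrite addnC [leRHS](big_cat_nat (n := k)) ?leq_addr//= lerDl.
  by apply: sumr_ge0.
rewrite [leLHS](big_cat_nat (n := N)) ?leq_addr//= big_mkord lerD2l.
have le_lim : series u (N + k) <= limn (series u).
  by apply: nondecreasing_cvgn_le => //; apply: nondecreasing_series.
apply: (@le_trans _ _ (series u (N + k) - series u N)); last by rewrite lerD2r.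
rewrite sub_series_geq ?leq_addr//.
by apply: ler_sum => n _; have /andP[] := Au n.
Unshelve. all: by end_near. Qed.

Variables (h : R -> R) (rad : nat -> R) (g q : R).
Hypothesis h_gt0 : forall t, 0 < t < 1 -> 0 < h t.
Hypothesis rad01 : forall n, 0 < rad n < 1.
Hypothesis h_decr : {in `]0, 1[ &,
     {homo (fun t => h t / t `^ q) : s t / s <= t >-> t <= s}}.
Hypothesis h_incr : {in `]0, 1[ &,
     {homo (fun t => h t / t `^ (2 + g - q)) : s t / s <= t}}.
Hypothesis gq : 2 + g <= 2 * q.

(** Contribution of one zero after normalisation, written with [q] in place of p: the surplus p - q
    cancels against the Schwarz-Pick factor. *)
Definition zero_term n (r : R) : R :=
  (1 - rad n) `^ q * (1 - rad n * r) `^ (2 + g - 2 * q) *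
  ((1 - r) `^ (q - g - 2) * h (1 - r)).

Lemma zero_term_ge0 n r : 0 < r < 1 -> 0 <= zero_term n r.
Proof.
move=> /andP[r0 r1]; apply: mulr_ge0; apply: mulr_ge0; rewrite ?powR_ge0//.
by apply/ltW/h_gt0; lra.
Qed.

(** Since 1 - rad n * r >= 1 - rad n and the exponent is nonpositive, the dependence on [r] reduces
    to h(t)/t^(2+g-q), the quantity that vanishes under the little-o assumption. *)
Lemma zero_term_le_scale n r : 0 < r < 1 ->
  zero_term n r <= (1 - rad n) `^ (2 + g - q) * (h (1 - r) / (1 - r) `^ (2 + g - q)).
Proof.
move=> /andP[r0 r1]; have /andP[u0 u1] := rad01 n.
have h0 : 0 < h (1 - r) by apply: h_gt0; lra.
have d0 : 0 < 1 - rad n by lra.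
have t0 : 0 < 1 - r by lra.
have -> : (1 - rad n) `^ (2 + g - q) = (1 - rad n) `^ q * (1 - rad n) `^ (2 + g - 2 * q).
  by rewrite -powRD_gt0//; congr (_ `^ _); ring.
rewrite -powRN (_ : - (2 + g - q) = q - g - 2); last by ring.
rewrite /zero_term [h _ * _]mulrC; apply: ler_wpM2r.
  by apply: mulr_ge0; rewrite ?powR_ge0// ltW.
apply: ler_wpM2l; first exact: powR_ge0.
rewrite (_ : 2 + g - 2 * q = - (2 * q - (2 + g))); last by ring.
apply: le_powRN => //; first nra.
by rewrite subr_ge0.
Qed.

Lemma zero_term_le n r : 0 < r < 1 -> zero_term n r <= h (1 - rad n).
Proof.
move=> r01; have /andP[r0 r1] := r01; have /andP[u0 u1] := rad01 n.
have h0 : 0 < h (1 - r) by apply: h_gt0; lra.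
have d0 : 0 < 1 - rad n by lra.
have t0 : 0 < 1 - r by lra.
have din : 1 - rad n \in `]0, 1[ by rewrite in_itv/=; apply/andP; split; lra.
have tin : 1 - r \in `]0, 1[ by rewrite in_itv/=; apply/andP; split; lra.
have [dt|td] := leP (1 - rad n) (1 - r); last first.
  apply: le_trans (zero_term_le_scale n r01) _.
  have := h_incr tin din (ltW td); rewrite ler_pdivlMr ?powR_gt0//.
  by rewrite mulrC.
have := h_decr din tin dt; rewrite ler_pdivlMr ?powR_gt0// mulrC.
apply: le_trans; rewrite /zero_term -mulrA; apply: ler_wpM2l; first exact: powR_ge0.
have -> : h (1 - r) / (1 - r) `^ q =
    (1 - r) `^ (2 + g - 2 * q) * ((1 - r) `^ (q - g - 2) * h (1 - r)).
  rewrite mulrA -powRD_gt0// (_ : 2 + g - 2 * q + (q - g - 2) = - q); last by ring.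
  by rewrite powRN mulrC.
apply: ler_wpM2r; first by apply: mulr_ge0; rewrite ?powR_ge0// ltW.
rewrite (_ : 2 + g - 2 * q = - (2 * q - (2 + g))); last by ring.
apply: le_powRN => //; first nra.
by rewrite subr_ge0.
Qed.

(** Taking real bounds also shows that [I r] is finite. The cut [N] stays free: the O estimate uses
    [N = 0], the o estimate a large [N]. *)
Lemma weighted_mean_le_zero_terms (I : R -> \bar R) (p C : R) : 0 < C ->
  (forall r, 0 <= I r)%E ->
  (forall r, 0 < r < 1 -> (I r <=
   \sum_(0 <= n <oo) (C * (1 - r) `^ (- (p - q)) *
     ((1 - rad n) `^ q * (1 - rad n * r) `^ (2 + g - 2 * q)))%:E)%E) ->
  cvgn (series (fun n => h (1 - rad n))) ->
  forall r N, 0 < r < 1 ->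
  (I r \is a fin_num) /\
  fine (I r) * ((1 - r) `^ (p - g - 2) * h (1 - r)) <=
    C * (\sum_(n < N) zero_term n r +
      (limn (series (fun n => h (1 - rad n))) - series (fun n => h (1 - rad n)) N)).
Proof.
move=> C0 I0 IC ch r N r01; have /andP[r0 r1] := r01.
have h0 : 0 < h (1 - r) by apply: h_gt0; lra.
have t0 : 0 < 1 - r by lra.
set P := (1 - r) `^ (p - g - 2) * h (1 - r).
have P0 : 0 < P by rewrite mulr_gt0// powR_gt0.
set b := _ + _.
have Ib : (I r <= (C / P * b)%:E)%E.
  apply: le_trans (IC r r01) _.
  have e n : C * (1 - r) `^ (- (p - q)) *
     ((1 - rad n) `^ q * (1 - rad n * r) `^ (2 + g - 2 * q)) = C / P * zero_term n r.
    have -> : (1 - r) `^ (- (p - q)) = (1 - r) `^ (q - g - 2) / (1 - r) `^ (p - g - 2).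
      by rewrite -powRN -powRD_gt0//; congr (_ `^ _); ring.
    rewrite /zero_term /P; field.
    by rewrite (gt_eqF h0) gt_eqF// powR_gt0.
  rewrite (eq_eseriesr (g := fun n => ((C / P)%:E * (zero_term n r)%:E)%E)); last first.
    by move=> n _; rewrite e.
  have CP : 0 < C / P by rewrite divr_gt0.
  rewrite nneseriesZl; last by move=> n _; rewrite lee_fin zero_term_ge0.
  rewrite [leRHS]EFinM; apply: lee_wpmul2l; first by rewrite lee_fin ltW.
  apply: nneseries_le_head_tail => // n.
  by rewrite zero_term_ge0//= zero_term_le.
have fI : I r \is a fin_num.
  by rewrite ge0_fin_numE//; apply: le_lt_trans Ib _; rewrite ltry.
split => //.
rewrite -ler_pdivlMr// [leRHS]mulrAC -lee_fin fineK//.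
Qed.

End ZeroTerms.

(** * The O(1) and o(1) estimates *)

Section Conclusion.
Context {R : realType}.
Variables (h : R -> R) (z : nat -> R[i]) (rad theta : nat -> R) (g q : R).
Hypothesis h_gt0 : forall t, 0 < t < 1 -> 0 < h t.
Hypothesis rad01 : forall n, 0 < rad n < 1.
Hypothesis z_polar : forall n, z n = polarC (rad n) (theta n).
Hypothesis z_blaschke : blaschke_sequence z.
Hypothesis h_summable : cvgn (series (fun n => h (1 - rad n))).
Hypothesis g01 : -1 < g < 0.
Hypothesis q01 : 1 + g / 2 < q <= 1.
Hypothesis h_decr : {in `]0, 1[ &,
     {homo (fun t => h t / t `^ q) : s t / s <= t >-> t <= s}}.
Hypothesis h_incr : {in `]0, 1[ &,
     {homo (fun t => h t / t `^ (2 + g - q)) : s t / s <= t}}.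

(** The witness for the O(1) and o(1) factors. For q <= p and r in ]0, 1[ the integral is finite, so
    [fine] keeps its value. *)
Definition normalized_mean (p r : R) : R :=
  fine (weighted_mean_integral (blaschke_product z) p g r) *
    ((1 - r) `^ (p - g - 2) * h (1 - r)).

Lemma weighted_mean_ge0 p r :
  (0 <= weighted_mean_integral (blaschke_product z) p g r)%E.
Proof.
apply: integral_ge0 => x; rewrite /= in_itv/= => /andP[x0 x1].
apply: integral_ge0 => t _; rewrite lee_fin; apply: mulr_ge0 (powR_ge0 _ _) _.
by apply: mulr_ge0 (powR_ge0 _ _); exact: ltW.
Qed.

Lemma normalized_mean_ge0 p r : 0 < r < 1 -> 0 <= normalized_mean p r.
Proof.
move=> /andP[r0 r1]; apply: mulr_ge0; first exact/fine_ge0/weighted_mean_ge0.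
by apply: mulr_ge0 (powR_ge0 _ _) _; apply/ltW/h_gt0; lra.
Qed.

Lemma near_left1 : \forall r \near (1 : R)^'-, 0 < r < 1.
Proof.
near=> r; apply/andP; split; near: r; last exact: nbhs_left_lt.
by apply: nbhs_left_gt.
Unshelve. all: by end_near. Qed.

Lemma normalized_mean_bound p : q <= p -> exists2 C : R, 0 < C &
  forall r N, 0 < r < 1 ->
  weighted_mean_integral (blaschke_product z) p g r =
    (normalized_mean p r / ((1 - r) `^ (p - g - 2) * h (1 - r)))%:E /\
  normalized_mean p r <= C * (\sum_(n < N) zero_term h rad g q n r +
      (limn (series (fun n => h (1 - rad n))) - series (fun n => h (1 - rad n)) N)).
Proof.
move=> qp.
have [C C0 IC] := weighted_mean_le rad01 z_polar z_blaschke g01 q01 qp.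
exists C => // r N r01.
have gq : 2 + g <= 2 * q by have /andP[? _] := q01; lra.
have [fI hI] := weighted_mean_le_zero_terms h_gt0 rad01 h_decr h_incr gq C0
  (weighted_mean_ge0 p) IC h_summable N r01.
split => //; rewrite /normalized_mean mulfK ?fineK// gt_eqF//.
have /andP[r0 r1] := r01.
by rewrite mulr_gt0 ?powR_gt0 ?h_gt0//; lra.
Qed.

Lemma normalized_mean_bigO p : q <= p ->
  normalized_mean p =O_ (1^'-) (cst (1 : R)).
Proof.
move=> qp; have [C C0 hC] := normalized_mean_bound qp.
set S := limn (series (fun n => h (1 - rad n))) in hC.
(* Read off from the bound itself at r = 1/2; it only serves to make the O constant positive. *)
have S0 : 0 <= C * S + 1.
  have r2 : 0 < (2^-1 : R) < 1 by rewrite invr_gt0 ltr0n/= invf_lt1// ltr1n.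
  have [_] := hC 2^-1 0%N r2; rewrite big_ord0 /series/= big_geq// subr0 add0r.
  by have := normalized_mean_ge0 p r2; lra.
apply/eqO_exP; exists (C * S + 2); first lra.
apply: filterS near_left1 => r r01.
rewrite normr1 mulr1 ger0_norm ?normalized_mean_ge0//.
have [_] := hC r 0%N r01; rewrite big_ord0 /series/= big_geq// subr0 add0r.
lra.
Qed.

Lemma normalized_mean_littleo p : q <= p ->
  h t / t `^ (2 + g - q) @[t --> 0^'+] --> 0 ->
  normalized_mean p =o_ (1^'-) (cst (1 : R)).
Proof.
move=> qp hlim; have [C C0 hC] := normalized_mean_bound qp.
apply/eqoP => e e0.
have e2 : 0 < e / (2 * C) by rewrite divr_gt0// mulr_gt0.
(* The tail gets half of e, with a cut [N] fixed before [r] tends to 1; [C] depends on neither. *)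
have [N _ hN] : \forall N \near \oo, limn (series (fun n => h (1 - rad n))) -
    series (fun n => h (1 - rad n)) N < e / (2 * C).
  move/cvgrPdist_lt : (h_summable) => /(_ _ e2); apply: filterS => N.
  exact: le_lt_trans (ler_norm _).
have {}hN := hN N (leqnn N).
set D := \sum_(n < N) (1 - rad n) `^ (2 + g - q).
have D0 : 0 <= D by apply: sumr_ge0 => n _; exact: powR_ge0.
(* The other half of e goes to the head, a finite sum at most [D] times h(t)/t^(2+g-q); the [+ 1]
   covers an empty head, where [D] is 0. *)
have e3 : 0 < e / (2 * C) / (D + 1) by rewrite divr_gt0// ltr_wpDl.
have ev : \forall r \near (1 : R)^'-,
    `|h (1 - r) / (1 - r) `^ (2 + g - q)| < e / (2 * C) / (D + 1).
  apply/nbhs_left0P; move/cvgr0Pnorm_lt : hlim => /(_ _ e3).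
  by apply: filterS => t; rewrite opprB addrCA subrr addr0.
apply: filterS2 near_left1 ev => r r01 hr.
rewrite normr1 mulr1 ger0_norm ?normalized_mean_ge0//.
have [_ hK] := hC r N r01; apply: le_trans hK _.
have -> : e = C * (e / (2 * C) + e / (2 * C)) by field; rewrite gt_eqF.
apply: ler_wpM2l; first exact: ltW.
apply: lerD; last exact: ltW.
apply: (@le_trans _ _ (D * (h (1 - r) / (1 - r) `^ (2 + g - q)))).
  rewrite mulr_suml; apply: ler_sum => n _; apply: zero_term_le_scale => //.
  by have /andP[? _] := q01; lra.
have := le_lt_trans (ler_norm _) hr; rewrite ltr_pdivlMr ?ltr_wpDl//.
set G := h _ / _ => hG.
have G0 : 0 <= G.
  have /andP[r0 r1] := r01.
  by rewrite divr_ge0 ?powR_ge0//; apply/ltW/h_gt0; lra.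
by rewrite mulrC; nra.
Qed.
End Conclusion.
Unset Implicit Arguments.
Theorem theorem5p1 (R : realType) (h : R -> R) (z : nat -> R[i])
  (rad theta : nat -> R) (gamma q : R)
  (h_gt0 : forall t, 0 < t < 1 -> 0 < h t)
  (h_cont : {within `]0, 1[, continuous h})
  (h_lim0 : h t @[t --> 0^'+] --> 0)
  (rad01 : forall n, 0 < rad n < 1)
  (z_polar : forall n, z n = polarC (rad n) (theta n))
  (z_blaschke : blaschke_sequence z)
  (h_summable : cvgn (series (fun n => h (1 - rad n))))
  (gamma_bnd : -1 < gamma < 0)
  (q_bnd : 1 + gamma / 2 < q <= 1)
  (h_decr : {in `]0, 1[ &,
     {homo (fun t => h t / t `^ q) : s t / s <= t >-> t <= s}})
  (h_incr : {in `]0, 1[ &,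
     {homo (fun t => h t / t `^ (2 + gamma - q)) : s t / s <= t}}) :
  (forall p : R, q <= p ->
     exists K : R -> R,
       K =O_ (1^'-) (cst (1 : R)) /\
       \forall r \near 1^'-,
         weighted_mean_integral (blaschke_product z) p gamma r
           = (K r / ((1 - r) `^ (p - gamma - 2) * h (1 - r)))%:E) /\
  (h t / t `^ (2 + gamma - q) @[t --> 0^'+] --> 0 ->
   forall p : R, q <= p ->
     exists K : R -> R,
       K =o_ (1^'-) (cst (1 : R)) /\
       \forall r \near 1^'-,
         weighted_mean_integral (blaschke_product z) p gamma r
           = (K r / ((1 - r) `^ (p - gamma - 2) * h (1 - r)))%:E).
Proof.
split=> [p qp|hlim p qp].
  exists (normalized_mean h z gamma p); split.
    exact: (normalized_mean_bigO h_gt0 rad01 z_polar z_blaschke h_summable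
      gamma_bnd q_bnd h_decr h_incr qp).
  have [C C0 hC] := normalized_mean_bound h_gt0 rad01 z_polar z_blaschke h_summable
    gamma_bnd q_bnd h_decr h_incr qp.
  (* Only the identity is used here; it holds at every cut, and 0 is an arbitrary choice. *)
  by apply: filterS near_left1 => r r01; have [] := hC r 0%N r01.
exists (normalized_mean h z gamma p); split.
  exact: (normalized_mean_littleo h_gt0 rad01 z_polar z_blaschke h_summable
    gamma_bnd q_bnd h_decr h_incr qp hlim).
have [C C0 hC] := normalized_mean_bound h_gt0 rad01 z_polar z_blaschke h_summable
  gamma_bnd q_bnd h_decr h_incr qp.
by apply: filterS near_left1 => r r01; have [] := hC r 0%N r01.
Qed.
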